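(* Let $\Omega\subset S^{n-1}$ be a closed set not contained in any closed hemisphere of $S^{n-1}$, and let $\rho_0:\Omega\rightarrow(0,\infty)$ and $f:\Omega\rightarrow\mathbb{R}$ be continuous. Let $\langle\rho_t\rangle$ be a logarithmic family of convex hulls generated by $(\rho_0,f)$, and let $q\neq0$, $j\neq n$. Then for every $Q\in\mathcal{S}_o^n$, $$\lim_{t\rightarrow0}\frac{\widetilde{W}_{q,j}(\langle\rho_t\rangle^\ast,Q)-\widetilde{W}_{q,j}(\langle\rho_0\rangle^\ast,Q)}{t}=-q\int_{\Omega}f(u)\,d\widetilde{\mathcal{C}}_{q,j}(\langle\rho_0\rangle^\ast,Q,u).$$
   Context: $\mathcal{K}_o^n$: convex bodies in $\mathbb{R}^n$ containing the origin in their interiors; $\mathcal{S}_o^n$: compact sets star-shaped about the origin with positive continuous radial function $\rho_Q(x)=\max\{\lambda\ge0:\lambda x\in Q\}$. $h_M$ is the support function, $du$ spherical Lebesgue measure. A logarithmic family of convex hulls generated by $(\rho_0,f)$: for some $\delta>0$ and each $t\in(-\delta,\delta)$, $\rho_t:\Omega\to(0,\infty)$ is continuous with $\log\rho_t(u)=\log\rho_0(u)+tf(u)+o(t,u)$, where $o(t,\cdot)$ is continuous on $\Omega$ and $o(t,\cdot)/t\to0$ uniformly on $\Omega$ as $t\to0$; and $\langle\rho_t\rangle=\mathrm{conv}\{\rho_t(u)u:u\in\Omega\}$. $K^*=\{x: x\cdot y\le1\ \forall y\in K\}$ is the polar body. For $q\in\mathbb{R}$, $j\ne n$, $M\in\mathcal{K}_o^n$,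 $Q\in\mathcal{S}_o^n$: $\widetilde{W}_{q,j}(M,Q)=\frac1n\int_{S^{n-1}}\rho_M^q\rho_Q^{n-q-j}\,du$; $R^*_M(\eta)=\{u\in S^{n-1}:\rho_M(u)u\cdot v=h_M(v)\text{ for some }v\in\eta\}$ for Borel $\eta\subseteq S^{n-1}$; and $\widetilde{\mathcal{C}}_{q,j}(M,Q,\eta)=\frac1n\int_{R^*_M(\eta)}\rho_M^q(u)\rho_Q^{n-q-j}(u)\,du$. *)

(* Defs.v *)
From HB Require Import structures.
From mathcomp Require Import all_boot all_order all_algebra.
From mathcomp Require Import all_classical all_reals all_analysis.
Import Order.TTheory GRing.Theory Num.Theory numFieldNormedType.Exports.

Set Implicit Arguments.
Unset Strict Implicit.
Unset Printing Implicit Defensive.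

Local Open Scope classical_set_scope.
Local Open Scope ring_scope.

Section Defs.
Context {R : realType} {n : nat}.
Local Notation V := 'rV[R]_n.

Definition dotp (x y : V) : R := \sum_(i < n) x ord0 i * y ord0 i.

Definition sphere : set V := [set u | dotp u u = 1].

Definition radial (Q : set V) (x : V) : R :=
  sup [set l : R | 0 <= l /\ Q (l *: x)].

Definition support (M : set V) (v : V) : R := sup [set dotp x v | x in M].

Definition polar (K : set V) : set V := [set x | forall y, K y -> dotp x y <= 1].

Definition conv (A : set V) : set V :=
  [set x | exists (k : nat) (lam : 'I_k -> R) (p : 'I_k -> V),
     [/\ forall i, 0 <= lam i, \sum_(i < k) lam i = 1,
         forall i, A (p i) & x = \sum_(i < k) lam i *: p i]].

Definition rho_hull (Omega : set V) (rho : V -> R) : set V :=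
  conv [set rho u *: u | u in Omega].

Definition star_body (Q : set V) : Prop :=
  [/\ compact Q,
      (forall x, Q x -> forall l : R, 0 <= l <= 1 -> Q (l *: x)),
      (forall u, sphere u -> 0 < radial Q u) &
      {within sphere, continuous (radial Q)}].

Definition log_family (Omega : set V) (rho0 f : V -> R) (rho : R -> V -> R) : Prop :=
  exists delta : R, 0 < delta /\
  exists o : R -> V -> R,
  [/\ forall u, Omega u -> rho 0 u = rho0 u,
      (forall t, `|t| < delta ->
         [/\ forall u, Omega u -> 0 < rho t u,
             {within Omega, continuous (rho t)},
             {within Omega, continuous (o t)} &
             forall u, Omega u -> ln (rho t u) = ln (rho0 u) + t * f u + o t u]) &
      (forall e : R, 0 < e -> exists d : R, 0 < d /\
         forall t, 0 < `|t| < d -> forall u, Omega u -> `|o t u / t| < e)].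

Definition box (a b : V) : set V :=
  [set x | forall i, a ord0 i <= x ord0 i < b ord0 i].
Definition box_vol (a b : V) : R := \prod_(i < n) (b ord0 i - a ord0 i).

Definition leb_outer (A : set V) : \bar R :=
  ereal_inf [set s | exists a b : nat -> V,
     [/\ forall k i, a k ord0 i <= b k ord0 i,
         A `<=` \bigcup_k box (a k) (b k) &
         s = (\sum_(k <oo) (box_vol (a k) (b k))%:E)%E]].

Definition leb_measurable (E : set V) : Prop :=
  forall A, leb_outer A = (leb_outer (A `&` E) + leb_outer (A `&` ~` E))%E.

Definition cone01 (E : set V) : set V :=
  [set x | exists (r : R) (u : V), [/\ 0 < r <= 1, E u, sphere u & x = r *: u]].

Definition sphere_measurable (E : set V) : Prop := leb_measurable (cone01 E).

Definition SphT := g_sigma_algebraType sphere_measurable.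

Definition sph_measure (E : set SphT) : \bar R := (n%:R%:E * leb_outer (cone01 E))%E.

Definition BorT := g_sigma_algebraType (@open V).

Definition dualW (q j : R) (M Q : set V) : R :=
  n%:R^-1 * fine (\int[sph_measure]_(u in (sphere : set SphT))
                    (radial M u `^ q * radial Q u `^ (n%:R - q - j))%:E)%E.

Definition Rstar (M : set V) (eta : set V) : set V :=
  [set u | sphere u /\ exists v, [/\ eta v, sphere v &
                                   radial M u * dotp u v = support M v]].

Definition dualC (q j : R) (M Q : set V) (eta : set BorT) : \bar R :=
  ((n%:R^-1)%:E * \int[sph_measure]_(u in (Rstar M (eta `&` sphere) : set SphT))
                    (radial M u `^ q * radial Q u `^ (n%:R - q - j))%:E)%E.

End Defs.

(* Main.v *)
Require Import Defs.
From HB Require Import structures.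
From mathcomp Require Import all_boot all_order all_algebra.
From mathcomp Require Import all_classical all_reals all_analysis.
From mathcomp Require Import ring lra measurable_realfun.
Import Order.TTheory GRing.Theory Num.Theory numFieldNormedType.Exports.
Set Implicit Arguments.
Unset Strict Implicit.
Unset Printing Implicit Defensive.
Local Open Scope classical_set_scope.
Local Open Scope ring_scope.

(* With g_t(x) = sup_(v in Omega) rho_t(v) (v . x), the support function of the hull,
   the polar body is {g_t <= 1} and its radial function on the sphere is 1 / g_t.
   At a direction u where the maximizer alpha(u) of rho_0(v) (v . u) is unique,
   Danskin's argument gives d/dt ln g_t(u) = f(alpha(u)) at t = 0; as ln g_t is
   Lipschitz in t uniformly on the sphere, dominated convergence differentiates the
   integral of g_t^(-q) rho_Q^(n-q-j).  The remaining directions lie in the set of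
   kinks of the convex function g_0, which is null: a kink of size e in a coordinate
   direction is a second difference of g_0 of order e, these telescope along a line,
   so many small translates of the set of such kinks overlap boundedly often.  Off the
   kinks the only subgradient of g_0 at u is rho_0(alpha(u)) alpha(u), hence alpha(u) is
   the only outer normal of the polar body in direction u, the reverse radial Gauss
   image of eta is alpha^-1(eta), and the dual curvature measure is the image under
   alpha of the measure with density g_0^(-q) rho_Q^(n-q-j) / n. *)

(** * Lebesgue outer measure *)

Section leb_outer_theory.
Context {R : realType} {n : nat}.
Local Notation V := 'rV[R]_n.+1.
Implicit Types (a b x z : V) (A B X : set V).

Lemma box_vol_ge0 a b : (forall i, a ord0 i <= b ord0 i) -> 0 <= box_vol a b.
Proof. by move=> ab; apply: prodr_ge0 => i _; rewrite subr_ge0. Qed.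

(** The product has at least one factor because the dimension is a successor; an empty product would
    be 1. *)
Lemma box_volxx a : box_vol a a = 0.
Proof. by rewrite /box_vol big_ord_recl subrr mul0r. Qed.

Lemma leb_outer_ge0 A : (0 <= leb_outer A)%E.
Proof.
apply: le_ereal_inf_tmp => s [a [b [ab _ ->]]].
by apply: nneseries_ge0 => k _ _; rewrite lee_fin box_vol_ge0.
Qed.

Lemma le_leb_outer : {homo @leb_outer R n.+1 : A B / A `<=` B >-> (A <= B)%E}.
Proof.
move=> A B AB; apply: ereal_inf_le_tmp => s [a [b [ab Bab ->]]].
by exists a, b; split => //; exact: subset_trans Bab.
Qed.

Lemma leb_outer_box a b : (forall i, a ord0 i <= b ord0 i) ->
  (leb_outer (box a b) <= (box_vol a b)%:E)%E.
Proof.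
move=> ab; apply: ereal_inf_lbound => /=.
(* Every box after the first is degenerate, with both corners at 0, and has zero volume. *)
exists (fun k => if k is 0 return V then a else 0),
  (fun k => if k is 0 return V then b else 0).
split; first by case.
- by move=> x abx; exists 0%N.
- rewrite nneseries_recl//; last by case=> [|k]; rewrite lee_fin ?box_volxx ?box_vol_ge0.
  by rewrite eseries0 ?adde0// => -[|k]// _ _; rewrite box_volxx.
Qed.

Lemma leb_outer0 : leb_outer (set0 : set V) = 0%E.
Proof.
apply/eqP; rewrite eq_le leb_outer_ge0 andbT.
apply: le_trans (le_leb_outer (sub0set (box (0 : V) 0))) _.
by apply: le_trans (leb_outer_box _) _ => //; rewrite box_volxx.
Qed.

(** Each [A k] is covered by boxes of total volume within e / 2^(k+1) of its outer measure; all
    these boxes together cover the union with an excess of at most e. *)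
Lemma leb_outer_sigma_subadditive : sigma_subadditive (@leb_outer R n.+1).
Proof.
move=> A; have [[i ioo]|Aoo] := pselect (exists i, leb_outer (A i) = +oo%E).
  by rewrite (eseries_pinfty _ _ ioo) ?leey// => k _;
    rewrite -ltNye (lt_le_trans _ (leb_outer_ge0 _)).
suff add2e (e : {posnum R}) :
    (leb_outer (\bigcup_n A n) <= \sum_(i <oo) leb_outer (A i) + e%:num%:E)%E.
  by apply/lee_addgt0Pr => _/posnumP[].
rewrite (le_trans _ (epsilon_trick _ _ _))//; last first.
  by move=> k; exact: leb_outer_ge0.
pose P k (ab : nat -> V * V) :=
  [/\ forall l i, (ab l).1 ord0 i <= (ab l).2 ord0 i,
      A k `<=` \bigcup_l box (ab l).1 (ab l).2 &
      (\sum_(l <oo) (box_vol (ab l).1 (ab l).2)%:E <=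
        leb_outer (A k) + (e%:num / (2 ^ k.+1)%:R)%:E)%E].
have [G PG] : {G : nat -> nat -> V * V & forall k, P k (G k)}.
  apply: (@choice _ _ P) => k.
  have fA : leb_outer (A k) \is a fin_num.
    rewrite ge0_fin_numE ?leb_outer_ge0// ltey; apply/eqP => Ak.
    by apply: Aoo; exists k.
  have e0 : 0 < e%:num / (2 ^ k.+1)%:R by [].
  have [_ [a [b [ab Aab ->]]] lt_e] := lb_ereal_inf_adherent e0 fA.
  by exists (fun l => (a l, b l)); split => //; exact: ltW.
have vol0 (p : nat * nat) :
    (0 <= (box_vol (G p.1 p.2).1 (G p.1 p.2).2)%:E)%E.
  by rewrite lee_fin box_vol_ge0// => i; have [+ _ _] := PG p.1; exact.
(* The bijection [h] lists the doubly indexed boxes as a single sequence; the volumes are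
   nonnegative, so their sum may be rearranged. *)
have /card_esym/ppcard_eqP[h] := card_nat2.
apply: (@le_trans _ _
  (\esum_(p in [set: nat * nat]) (box_vol (G p.1 p.2).1 (G p.1 p.2).2)%:E)%E).
  apply: ereal_inf_lbound => /=.
  exists (fun k => (G (h k).1 (h k).2).1), (fun k => (G (h k).1 (h k).2).2).
  split => [k i||].
  - by have [+ _ _] := PG (h k).1; exact.
  - move=> x [k _ Akx]; have [_ /(_ _ Akx)[l _ xl] _] := PG k.
    by exists (h^-1%FUN (k, l)) => //=; rewrite invK ?inE.
  - rewrite nneseries_esumT; last by move=> k; exact: (vol0 (h k)).
    by rewrite (reindex_esum [set: nat] _ h).
rewrite (_ : esum _ _ = \sum_(k <oo) \sum_(l <oo)
   (box_vol (G k l).1 (G k l).2)%:E)%E; last first.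
  rewrite (_ : [set: nat * nat] = [set: nat] `*`` (fun=> [set: nat])); last first.
    by rewrite predeqE => -[k l]; split.
  rewrite -(@esum_esum _ _ _ _ _ (fun k l => (box_vol (G k l).1 (G k l).2)%:E)); last first.
    by move=> k l _ _; exact: (vol0 (k, l)).
  rewrite nneseries_esumT//; last first.
    by move=> k; apply: nneseries_ge0 => l _ _; exact: (vol0 (k, l)).
  apply: eq_esum => k _; rewrite nneseries_esumT// => l; exact: (vol0 (k, l)).
apply: lee_nneseries => [k _ _|k _]; last by have [] := PG k.
by apply: nneseries_ge0 => l _ _; exact: (vol0 (k, l)).
Qed.

HB.instance Definition _ := isOuterMeasure.Build R V (@leb_outer R n.+1)
  leb_outer0 leb_outer_ge0 le_leb_outer leb_outer_sigma_subadditive.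

Lemma leb_outer_translate A z : leb_outer [set x | A (x + z)] = leb_outer A.
Proof.
suff H B y : (leb_outer [set x | B (x + y)%R] <= leb_outer B)%E.
  apply/eqP; rewrite eq_le H/=.
  have -> : A = [set x | [set x | A (x + z)] (x + - z)].
    by apply/funext => x /=; rewrite subrK.
  apply: le_trans (H _ _) _; apply: le_leb_outer => x /=.
  by rewrite subrK.
apply: ereal_inf_le_tmp => s [a [b [ab Bab ->]]].
exists (fun k => a k - y), (fun k => b k - y); split => [k i||].
- by rewrite !mxE lerD2r.
- move=> x /Bab[k _ xk]; exists k => // i; have := xk i.
  by rewrite !mxE lerBlDr ltrBrDr.
- apply: eq_eseriesr => k _; congr EFin; apply: eq_bigr => i _.
  by rewrite !mxE; lra.
Qed.

(** A hyperplane orthogonal to an axis cuts each box of a cover into two boxes whose volumes add up,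
    so one cover yields covers of both pieces of [X]. *)
Lemma leb_measurable_halfspace (i : 'I_n.+1) (c : R) :
  leb_measurable [set x : V | x ord0 i < c].
Proof.
apply: le_caratheodory_measurable => X.
apply: le_ereal_inf_tmp => s [a [b [ab Xab ->]]].
(* The cut is made at [c] clamped to the extent of the box; if the hyperplane misses the box, one
   piece has zero volume. *)
pose m k := Num.max (a k ord0 i) (Num.min (b k ord0 i) c).
pose u (x : V) (y : R) : V := \row_j if j == i then y else x ord0 j.
have am k : a k ord0 i <= m k by rewrite le_max lexx.
have mb k : m k <= b k ord0 i by rewrite ge_max ab ge_min lexx.
have uvol k : box_vol (a k) (b k) =
    box_vol (a k) (u (b k) (m k)) + box_vol (u (a k) (m k)) (b k).
  have D (x y : V) : box_vol x y = (y ord0 i - x ord0 i) *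
      \prod_(j < n.+1 | j != i) (y ord0 j - x ord0 j) by rewrite /box_vol (bigD1 i).
  rewrite !D !mxE eqxx.
  under [X in _ = _ * X + _]eq_bigr => j ji do rewrite mxE (negbTE ji).
  under [X in _ = _ + _ * X]eq_bigr => j ji do rewrite mxE (negbTE ji).
  by rewrite -mulrDl [m k - _ + _]addrC addrA subrK.
have au k j : a k ord0 j <= u (b k) (m k) ord0 j.
  by rewrite mxE; case: eqP => [->|_].
have ub k j : u (a k) (m k) ord0 j <= b k ord0 j.
  by rewrite mxE; case: eqP => [->|_].
under eq_eseriesr => k _ do rewrite uvol EFinD.
rewrite nneseriesD; try by move=> k _ _; rewrite lee_fin box_vol_ge0.
apply: leeD; apply: ereal_inf_lbound => /=.
- exists a, (fun k => u (b k) (m k)); split => // x [/Xab[k _ xk] xc].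
  exists k => // j; have := xk j; rewrite mxE; case: eqP => // -> /andP[-> xb] /=.
  by rewrite lt_max lt_min xb xc orbT.
- exists (fun k => u (a k) (m k)), b; split => // x [/Xab[k _ xk] /negP xc].
  exists k => // j; have := xk j; rewrite mxE; case: eqP => // -> /andP[ax ->].
  by rewrite andbT ge_max ax ge_min [c <= _]leNgt xc orbT.
Qed.

Local Notation T := (caratheodory_type (@leb_outer R n.+1)).

Lemma leb_measurable_box a b : leb_measurable (box a b).
Proof.
rewrite (_ : box a b = \bigcap_(i in [set: 'I_n.+1])
   ([set x : V | x ord0 i < b ord0 i] `\` [set x : V | x ord0 i < a ord0 i])).
  apply: (@fin_bigcap_measurable _ T) => // i _.
  by apply: (@measurableD _ T); exact: leb_measurable_halfspace.
apply/seteqP; split => [x xab i _|x xab i].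
  by have /andP[ax xb] := xab i; split => //=; apply/negP; rewrite -leNgt.
have [xb /negP] := xab i I; rewrite -leNgt => ax.
by apply/andP.
Qed.

Lemma leb_measurable_open A : open A -> leb_measurable A.
Proof.
move=> oA.
(* [A] is the union of the rational boxes inside it. Boxes that stick out are replaced by the empty
   set, so that the index type is countable. *)
pose F (pq : 'rV[rat]_n.+1 * 'rV[rat]_n.+1) : set V :=
  let B := box (map_mx (@ratr R) pq.1) (map_mx (@ratr R) pq.2) in
  if `[< B `<=` A >] then B else set0.
rewrite (_ : A = \bigcup_pq F pq).
  apply: (@countable_bigcupT_measurable _ T) => // pq; rewrite /F.
  by case: ifP => _; [exact: leb_measurable_box|exact: (@measurable0 _ T)].
apply/seteqP; split => [x Ax|x [pq _]]; last first.
  by rewrite /F; case: ifPn => // /asboolP; exact.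
have /nbhs_ballP[e /= e0 xeA] := open_nbhs_nbhs (conj oA Ax).
have /choice[p hp] : forall i, exists p : rat,
    x ord0 i - e < ratr p < x ord0 i.
  move=> i; have [|p] := @rat_in_itvoo R (x ord0 i - e) (x ord0 i); first by lra.
  by rewrite in_itv /=; exists p.
have /choice[q hq] : forall i, exists q : rat,
    x ord0 i < ratr q < x ord0 i + e.
  move=> i; have [|q] := @rat_in_itvoo R (x ord0 i) (x ord0 i + e); first by lra.
  by rewrite in_itv /=; exists q.
have BA : box (map_mx (@ratr R) (\row_i p i)) (map_mx (@ratr R) (\row_i q i)) `<=` A.
  move=> y yB; apply: xeA; split => // k i; rewrite ord1.
  have := yB i; rewrite !mxE /ball/= ltr_norml.
  by have := hp i; have := hq i; lra.
exists (\row_i p i, \row_i q i) => //; rewrite /F asboolT//= => i.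
by rewrite !mxE; have := hp i; have := hq i; lra.
Qed.

Lemma leb_measurable_closed A : closed A -> leb_measurable A.
Proof.
move=> cA; rewrite -(setCK A); apply: (@measurableC _ T).
exact/leb_measurable_open/closed_openC.
Qed.

End leb_outer_theory.

(** * Inner product and unit sphere *)

Lemma continuous_sumr {R : realType} {T : topologicalType} {I : Type} (r : seq I)
    (F : I -> T -> R) :
  (forall i, continuous (F i)) -> continuous (fun x => \sum_(i <- r) F i x).
Proof.
move=> cF; elim: r => [|i r IH].
  rewrite [X in continuous X](_ : _ = cst 0); first exact: cst_continuous.
  by apply/funext => x; rewrite big_nil.
rewrite [X in continuous X](_ : _ = (fun x => F i x + \sum_(k <- r) F k x)).
  by move=> x; apply: cvgD; [exact: cF|exact: IH].
by apply/funext => x; rewrite big_cons.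
Qed.

Section dotp_theory.
Context {R : realType} {n : nat}.
Local Notation V := 'rV[R]_n.
Implicit Types (x y z u v : V) (l : R).

Lemma dotpC x y : dotp x y = dotp y x.
Proof. by apply: eq_bigr => i _; rewrite mulrC. Qed.

Lemma dotpDl x y z : dotp (x + y) z = dotp x z + dotp y z.
Proof. by rewrite -big_split; apply: eq_bigr => i _; rewrite mxE mulrDl. Qed.

Lemma dotpDr x y z : dotp z (x + y) = dotp z x + dotp z y.
Proof. by rewrite !(dotpC z) dotpDl. Qed.

Lemma dotpZl l x y : dotp (l *: x) y = l * dotp x y.
Proof. by rewrite mulr_sumr; apply: eq_bigr => i _; rewrite mxE mulrA. Qed.

Lemma dotpZr l x y : dotp x (l *: y) = l * dotp x y.
Proof. by rewrite dotpC dotpZl dotpC. Qed.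

Lemma dotpNl x y : dotp (- x) y = - dotp x y.
Proof. by rewrite -scaleN1r dotpZl mulN1r. Qed.

Lemma dotp_delta x i : dotp (delta_mx ord0 i) x = x ord0 i.
Proof.
rewrite /dotp (bigD1 i)//= mxE !eqxx mul1r big1 ?addr0// => k ki.
by rewrite mxE (negbTE ki) andbF mul0r.
Qed.

Lemma dotp_ge0 x : 0 <= dotp x x.
Proof. by apply: sumr_ge0 => i _; rewrite -expr2 sqr_ge0. Qed.

Lemma dotp_eq0 x : (dotp x x == 0) = (x == 0).
Proof.
apply/eqP/eqP => [/eqP|->]; last by rewrite /dotp big1// => i _; rewrite mxE mul0r.
rewrite psumr_eq0; last by move=> i _; rewrite -expr2 sqr_ge0.
move=> /allP x0; apply/rowP => i; have := x0 i (mem_index_enum i).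
by rewrite /= mulf_eq0 orbb mxE => /eqP.
Qed.

Lemma dotp_gt0 x : (0 < dotp x x) = (x != 0).
Proof. by rewrite lt_neqAle eq_sym dotp_eq0 dotp_ge0 andbT. Qed.

Lemma dotp_le_sqr x y : 2 * dotp x y <= dotp x x + dotp y y.
Proof.
rewrite mulr_sumr -big_split; apply: ler_sum => i _ /=; rewrite -subr_ge0.
have -> : x ord0 i * x ord0 i + y ord0 i * y ord0 i - 2 * (x ord0 i * y ord0 i) =
  (x ord0 i - y ord0 i) ^+ 2 by lra.
exact: sqr_ge0.
Qed.

Lemma coord_sqr_le_dotp x i : x ord0 i ^+ 2 <= dotp x x.
Proof.
by rewrite /dotp (bigD1 i)//= expr2 lerDl sumr_ge0// => k _; rewrite -expr2 sqr_ge0.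
Qed.

Lemma continuous_dotp_self : continuous (fun x => dotp x x).
Proof.
apply: continuous_sumr => i x.
have ci : {for x, continuous (fun y : V => y ord0 i)} by exact: coord_continuous.
exact: (continuousM ci ci).
Qed.

Lemma sphere_normalize x : x != 0 -> sphere ((Num.sqrt (dotp x x))^-1 *: x).
Proof.
move=> x0; rewrite /sphere/= dotpZl dotpZr mulrA -expr2 exprVn.
by rewrite sqr_sqrtr ?dotp_ge0// mulVf// dotp_eq0.
Qed.

Lemma sphere_neq0 u : sphere u -> u != 0.
Proof.
by rewrite /sphere/= => u1; rewrite -dotp_eq0 u1 oner_eq0.
Qed.

(** Uniqueness of polar coordinates: comparing squared lengths gives r = s, and the common factor
    cancels. *)
Lemma sphere_scale_eq u v (r s : R) : sphere u -> sphere v -> 0 < r -> 0 < s ->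
  r *: u = s *: v -> u = v.
Proof.
move=> u1 v1 r0 s0 ruv.
have : dotp (r *: u) (r *: u) = dotp (s *: v) (s *: v) by rewrite ruv.
rewrite !dotpZl !dotpZr u1 v1 !mulr1 -!expr2 => /eqP.
rewrite eqrXn2 ?ltW// => /eqP rs; move: ruv; rewrite rs => /scalerI; apply.
by rewrite gt_eqF.
Qed.

Lemma closed_sphere : closed (@sphere R n).
Proof.
apply: (@preimage_closed _ _ (fun x => dotp x x) [set 1]) => //.
by move=> x _; exact: continuous_dotp_self.
Qed.

Lemma sphere_coord_le1 u i : sphere u -> `|u ord0 i| <= 1.
Proof.
by move=> u1; have := coord_sqr_le_dotp u i; rewrite u1 ler_norml => ?; apply/andP; split; nra.
Qed.

Lemma normr_rV_le x (M : R) : 0 <= M -> (forall i, `|x ord0 i| <= M) -> `|x| <= M.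
Proof.
move=> M0 xM; rewrite [leLHS]/Num.norm/= mx_normrE.
by apply/bigmax_leP; split => // -[k i] _ /=; rewrite ord1.
Qed.

Lemma compact_sphere : compact (@sphere R n).
Proof.
apply: bounded_closed_compact; last exact: closed_sphere.
exists 1; split => // M M1 u u1; apply: normr_rV_le.
  by rewrite ltW// (lt_trans _ M1).
by move=> i; rewrite (le_trans _ (ltW M1))// sphere_coord_le1.
Qed.

End dotp_theory.

(** * Spherical measure *)

Section spherical_measure.
Context {R : realType} {n : nat}.
Local Notation V := 'rV[R]_n.+1.
Local Notation T := (caratheodory_type (@leb_outer R n.+1)).
Local Notation SphT := (@SphT R n.+1).
Local Notation BorT := (@BorT R n.+1).
Implicit Types (E F : set V).

Lemma cone01_sub E F : E `&` sphere `<=` F -> cone01 E `<=` cone01 F.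
Proof. by move=> EF x [r [u [r01 Eu u1 ->]]]; exists r, u; split => //; exact: EF. Qed.

Lemma cone01_set0 : cone01 (set0 : set V) = set0.
Proof. by apply/seteqP; split => // x [r [u [_ []]]]. Qed.

Lemma cone01_bigcup (F : nat -> set V) :
  cone01 (\bigcup_k F k) = \bigcup_k cone01 (F k).
Proof.
apply/seteqP; split => [x [r [u [r01 [k _ Fu] u1 ->]]]|x [k _ [r [u [r01 Fu u1 ->]]]]].
  by exists k => //; exists r, u.
by exists r, u; split => //; exists k.
Qed.

Lemma cone01_disjoint E F : E `&` F = set0 -> cone01 E `&` cone01 F = set0.
Proof.
move=> EF0; apply/seteqP; split => // x [[r [u [/andP[r0 _] Eu u1 ->]]]].
move=> [s [v [/andP[s0 _] Fv v1 /(sphere_scale_eq u1 v1 r0 s0) uv]]].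
have : (E `&` F) u by split => //; rewrite uv.
by rewrite EF0.
Qed.

Lemma cone01_setC E : cone01 (~` E) = cone01 setT `\` cone01 E.
Proof.
apply/seteqP; split => x.
  move=> Ex; split; first by apply: cone01_sub Ex.
  move=> Ex'; suff : (cone01 (~` E) `&` cone01 E) x by rewrite cone01_disjoint ?setICl.
  by split.
move=> [[r [u [r01 _ u1 xE]]] nE]; exists r, u; split => // Eu.
by apply: nE; exists r, u.
Qed.

(** Turns the cone into a preimage, to which continuity applies. Normalization sends 0 to 0, so
    removing 0 from [E] keeps the apex out. *)
Lemma cone01E E : cone01 E =
  [set x : V | dotp x x <= 1] `&`
  (fun x => (Num.sqrt (dotp x x))^-1 *: x) @^-1` (E `&` ~` [set 0]).
Proof.
apply/seteqP; split => [x [r [u [/andP[r0 r1] Eu u1 ->]]]|x /= [x1 [Ex x0]]].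
  have dr : dotp (r *: u) (r *: u) = r ^+ 2.
    by rewrite dotpZl dotpZr u1 mulr1 expr2.
  split; rewrite /= dr; first by rewrite expr_le1// ltW.
  rewrite sqrtr_sqr gtr0_norm// scalerA mulVf ?gt_eqF// scale1r; split => // uE.
  by have := sphere_neq0 u1; rewrite uE eqxx.
have x'0 : x != 0 by apply/eqP => x0'; apply: x0; rewrite x0' scaler0.
have d0 : 0 < dotp x x by rewrite dotp_gt0.
exists (Num.sqrt (dotp x x)), ((Num.sqrt (dotp x x))^-1 *: x); split => //.
- by rewrite sqrtr_gt0 d0 -sqrtr1 ler_wsqrtr.
- exact: sphere_normalize.
- by rewrite scalerA divff ?scale1r// gt_eqF// sqrtr_gt0.
Qed.

(** The cone is the closed unit ball intersected with the preimage of an open set under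
    normalization, which is continuous away from the origin. *)
Lemma open_sphere_measurable E : open E -> sphere_measurable E.
Proof.
move=> oE; rewrite /sphere_measurable cone01E.
apply: (@measurableI _ T).
  apply: leb_measurable_closed.
  apply: (@preimage_closed _ _ (fun x : V => dotp x x) [set r | r <= 1]) => //.
  by move=> x _; exact: continuous_dotp_self.
apply: leb_measurable_open; apply: open_comp; last first.
  by apply: openI => //; apply: closed_openC;
    exact/accessible_closed_set1/hausdorff_accessible/norm_hausdorff.
move=> x; rewrite inE => -[_ /= x0]; have {}x0 : x != 0.
  by apply/eqP => x0'; apply: x0; rewrite x0' scaler0.
have cs : {for x, continuous (fun y : V => Num.sqrt (dotp y y))}.
  apply: (@continuous_comp _ _ _ (fun y : V => dotp y y) Num.sqrt).
    exact: continuous_dotp_self.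
  exact: sqrt_continuous.
have cV : {for x, continuous (fun y : V => (Num.sqrt (dotp y y))^-1)}.
  by apply: continuousV cs; rewrite gt_eqF// sqrtr_gt0 dotp_gt0.
have ci : {for x, continuous (fun y : V => y)} by exact: cvg_id.
exact: (continuousZ cV ci).
Qed.

(** Hence the sigma-algebra generated in [SphT] is [sphere_measurable] itself, and Carathéodory's
    theory applies to cones. *)
Lemma sphere_measurable_sigma_algebra :
  sigma_algebra setT (@sphere_measurable R n.+1).
Proof.
split.
- by rewrite /sphere_measurable cone01_set0; exact: (@measurable0 _ T).
- move=> E mE; rewrite setTD /sphere_measurable cone01_setC.
  by apply: (@measurableD _ T) => //; apply: open_sphere_measurable; exact: openT.
- move=> F mF; rewrite /sphere_measurable cone01_bigcup.
  exact: (@bigcupT_measurable _ T).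
Qed.

Lemma measurable_SphTE : (measurable : set (set SphT)) = sphere_measurable.
Proof. exact: measurable_g_measurableTypeE sphere_measurable_sigma_algebra. Qed.

Lemma measurable_BorT_SphT E : measurable (E : set BorT) -> measurable (E : set SphT).
Proof.
rewrite measurable_SphTE; apply: smallest_sub.
  exact: sphere_measurable_sigma_algebra.
by move=> A oA; exact: open_sphere_measurable.
Qed.

Lemma sph_measure0 : sph_measure (set0 : set SphT) = 0%E.
Proof. by rewrite /sph_measure cone01_set0 leb_outer0 mule0. Qed.

Lemma sph_measure_ge0 (E : set SphT) : (0 <= sph_measure E)%E.
Proof. by rewrite mule_ge0// leb_outer_ge0. Qed.

Lemma sph_measure_sigma_additive : semi_sigma_additive (@sph_measure R n.+1).
Proof.
move=> F; rewrite measurable_SphTE => mF tF mUF.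
rewrite /sph_measure cone01_bigcup.
rewrite [X in X @ _ --> _](_ : _ = (fun m => n.+1%:R%:E *
    \sum_(0 <= i < m) leb_outer (cone01 (F i))))%E; last first.
  by apply/funext => m; rewrite ge0_sume_distrr// => i _; exact: leb_outer_ge0.
apply: cvgeZl => //.
apply: (@caratheodory_measure_sigma_additive _ _ (@leb_outer R n.+1)).
- by move=> k; exact: mF.
- apply/trivIsetP => i k _ _ ik; apply: cone01_disjoint.
  by move/trivIsetP : tF; exact.
- by rewrite -cone01_bigcup; exact: mUF.
Qed.

HB.instance Definition _ := isMeasure.Build _ SphT R (@sph_measure R n.+1)
  sph_measure0 sph_measure_ge0 sph_measure_sigma_additive.

Lemma leb_outer_bounded_fin E (M : R) :
  (forall x, E x -> forall i, `|x ord0 i| < M) -> (leb_outer E < +oo)%E.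
Proof.
move=> EM; have [M0|M0] := leP 0 M; last first.
  have -> : E = set0; last by rewrite leb_outer0.
  apply/seteqP; split => // x /EM/(_ ord0) H.
  by have := normr_ge0 (x ord0 ord0); lra.
apply: (@le_lt_trans _ _ (leb_outer (box (\row_(i < n.+1) (- M)) (\row_(i < n.+1) M)))).
  apply: le_leb_outer => x /EM xM i; have := xM i.
  by rewrite !mxE ltr_norml; lra.
by apply: le_lt_trans (leb_outer_box _) _; [move=> i; rewrite !mxE; lra|rewrite ltey].
Qed.

Lemma sph_measure_fin (E : set SphT) : (sph_measure E < +oo)%E.
Proof.
apply: lte_mul_pinfty => //; apply: (@leb_outer_bounded_fin _ 2) => x.
move=> [r [u [/andP[r0 r1] _ u1 ->]]] i; rewrite mxE normrM gtr0_norm//.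
have := sphere_coord_le1 i u1; have := normr_ge0 (u ord0 i); nra.
Qed.

(** Completeness of the spherical measure. It is needed because reverse Gauss images and preimages
    under the maximizer map are controlled only up to subsets of a null set. *)
Lemma measurable_sph_measure_eq0 (E : set SphT) : sph_measure E = 0%E -> measurable E.
Proof.
move=> /eqP; rewrite mule_eq0 => /orP[/eqP[]/eqP|/eqP E0]; first by rewrite pnatr_eq0.
rewrite measurable_SphTE.
apply: (@measure_is_complete_caratheodory _ _ (@leb_outer R n.+1)).
exists (cone01 E); split => //.
apply: le_caratheodory_measurable => X.
rewrite [X in (X + _ <= _)%E](_ : _ = 0%E).
  by rewrite add0e; apply: le_leb_outer; exact: subIsetl.
apply/eqP; rewrite eq_le leb_outer_ge0 andbT -E0.
by apply: le_leb_outer; exact: subIsetr.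
Qed.

Lemma within_continuous_measurable (A : set V) (g : V -> R) :
  measurable (A : set BorT) -> {within A, continuous g} ->
  measurable_fun (A : set BorT) (g : BorT -> R).
Proof.
move=> mA /continuousP cg; apply: (measurability _ (RGenOpens.measurableE R)).
move=> _ [_ [a [b ->] <-]].
have /cg/open_subspaceP[W oW WA] := @interval_open R (BRight a) (BLeft b) isT isT.
rewrite setIC -WA; apply: measurableI => //.
exact: sub_sigma_algebra.
Qed.

Lemma measurable_fun_BorT_SphT (A : set V) (g : V -> R) :
  measurable_fun (A : set BorT) (g : BorT -> R) ->
  measurable (A : set BorT) ->
  measurable_fun (A : set SphT) (g : SphT -> R).
Proof.
by move=> mg mA _ B mB; apply: measurable_BorT_SphT; exact: mg.
Qed.

Lemma measurable_closed_BorT A : closed A -> measurable (A : set BorT).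
Proof.
move=> cA; rewrite -(setCK A); apply: measurableC.
by apply: sub_sigma_algebra; exact: closed_openC.
Qed.

End spherical_measure.

(** Sets inside [B] that overlap at most [m] times have total measure at most [m] times that of [B]:
    the inequality between indicators is integrated. *)
Lemma sum_measure_le d (T : measurableType d) (R : realType)
    (mu : {measure set T -> \bar R}) (K : nat) (E : nat -> set T) (B : set T) (m : R) :
  0 <= m -> (forall k, measurable (E k)) -> measurable B ->
  (forall x, \sum_(k < K) \1_(E k) x <= m * \1_B x) ->
  (\sum_(k < K) mu (E k) <= m%:E * mu B)%E.
Proof.
move=> m0 mE mB EB.
have -> : (\sum_(k < K) mu (E k) = \int[mu]_x (\sum_(k < K) (\1_(E k) x)%:E))%E.
  rewrite ge0_integral_sum//.
  - by apply: eq_bigr => k _; rewrite integral_indic// setIT.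
  - by move=> k; exact/measurable_EFinP/measurable_indic.
have -> : (m%:E * mu B = \int[mu]_x (m%:E * (\1_B x)%:E))%E.
  rewrite ge0_integralZl_EFin//; first by rewrite integral_indic// setIT.
  exact/measurable_EFinP/measurable_indic.
apply: ge0_le_integral => //.
- by move=> x _; apply: sume_ge0 => k _; rewrite lee_fin.
- by apply: emeasurable_sum => k; exact/measurable_EFinP/measurable_indic.
- by apply/measurable_EFinP/measurable_funM => //; exact: measurable_indic.
- by move=> x _; rewrite sumEFin -EFinM lee_fin.
Qed.

(** * Kinks of sublinear functions *)

Section sublinear.
Context {R : realType} {n : nat}.
Local Notation V := 'rV[R]_n.
Implicit Types (g : V -> R) (x y a b : V).

Definition sublinear g :=
  (forall l x, 0 <= l -> g (l *: x) = l * g x) /\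
  (forall x y, g (x + y) <= g x + g y).

Definition unit_vec (i : 'I_n) : V := delta_mx ord0 i.

(* For a sublinear [g], the points of [kink g i e] are those where the two
   one-sided derivatives of [g] in the direction [i] differ by at least [e]. *)
Definition kink g (i : 'I_n) (e : R) : set V :=
  [set x | forall s, 0 < s ->
     e * s <= g (x + s *: unit_vec i) + g (x - s *: unit_vec i) - 2 * g x].

(** For sublinear [g] these are the points where some pair of one-sided partial derivatives
    disagrees; the thresholds 1 / (k + 1) make the union countable. *)
Definition kinks g : set V := \bigcup_i \bigcup_k kink g i k.+1%:R^-1.

(** If the i-th coordinates of two subgradients differ, using the larger one forwards and the
    smaller one backwards along axis i bounds the second difference below by their gap times the
    step, which makes [x] a kink. *)
Lemma unique_subgradient g x a b : ~ kinks g x ->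
  (forall y, dotp a y <= g y) -> (forall y, dotp b y <= g y) ->
  dotp a x = g x -> dotp b x = g x -> a = b.
Proof.
move=> xN ag bg ax bx; apply/rowP => i.
suff H (c d : V) : (forall y, dotp c y <= g y) -> (forall y, dotp d y <= g y) ->
    dotp c x = g x -> dotp d x = g x -> c ord0 i <= d ord0 i.
  by apply/eqP; rewrite eq_le !H.
move=> cg dg cx dx; rewrite leNgt; apply/negP => dc; apply: xN.
have [k ek] : exists k : nat, k.+1%:R^-1 <= c ord0 i - d ord0 i.
  have := near_infty_natSinv_lt (PosNum (eq_rect _ is_true dc _ (esym (subr_gt0 _ _)))).
  by move=> [k _ /(_ k (leqnn k)) /ltW]; exists k.
exists i => //; exists k => //; move: ek; move: (k.+1%:R^-1) => r ek s s0.
have line (a' : V) t : dotp a' (x + t *: unit_vec i) = dotp a' x + t * a' ord0 i.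
  by rewrite dotpDr dotpZr (dotpC a' (unit_vec i)) dotp_delta.
have := cg (x + s *: unit_vec i); have := dg (x + (- s) *: unit_vec i).
rewrite !line scaleNr cx dx => dB cD; have := ler_wpM2r (ltW s0) ek; lra.
Qed.

Section sublinear_theory.
Context (g : V -> R) (sg : sublinear g).

Let gZ l x : 0 <= l -> g (l *: x) = l * g x. Proof. exact: sg.1. Qed.
Let gD x y : g (x + y) <= g x + g y. Proof. exact: sg.2. Qed.

Lemma sublinear0 : g 0 = 0.
Proof. by rewrite -(scale0r (0 : V)) gZ// mul0r. Qed.

(** Subadditivity reduces to g (x - y), which is expanded in the coordinate basis. Homogeneity holds
    for nonnegative factors only, so both g (e_i) and g (- e_i) enter the constant. *)
Lemma sublinear_lipschitz : exists2 C, 0 <= C & forall x y, g x - g y <= C * `|x - y|.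
Proof.
pose c i := `|g (unit_vec i)| + `|g (- unit_vec i)|.
have c0 i : 0 <= c i by rewrite addr_ge0.
exists (\sum_i c i); first exact: sumr_ge0.
move=> x y; have := gD (x - y) y; rewrite subrK -lerBlDr => /le_trans; apply.
rewrite mulr_suml [X in g X](row_sum_delta (x - y)).
apply: (@le_trans _ _ (\sum_i g ((x - y) ord0 i *: unit_vec i))).
  elim/big_rec2: _ => [|i u v _ uv]; first by rewrite sublinear0.
  by rewrite (le_trans (gD _ _))// lerD2l.
apply: ler_sum => i _.
have xi : `|(x - y) ord0 i| <= `|x - y|.
  rewrite [leRHS]/Num.norm/= mx_normrE.
  by apply: (le_bigmax _ (fun ij : 'I_1 * 'I_n => `|(x - y) ij.1 ij.2|) (ord0, i)).
apply: (@le_trans _ _ (c i * `|(x - y) ord0 i|)); last exact: ler_wpM2l.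
have [r0|r0] := leP 0 ((x - y) ord0 i).
  rewrite gZ// ger0_norm// mulrC ler_wpM2r// (le_trans (ler_norm _))//.
  by rewrite lerDl.
have -> : (x - y) ord0 i *: unit_vec i = (- (x - y) ord0 i) *: (- unit_vec i).
  by rewrite scaleNr scalerN opprK.
rewrite gZ ?oppr_ge0 ?(ltW r0)// ltr0_norm// mulrC ler_wpM2r ?oppr_ge0 ?(ltW r0)//.
by rewrite (le_trans (ler_norm _))// lerDr.
Qed.

Lemma sublinear_continuous : continuous g.
Proof.
have [C C0 gC] := sublinear_lipschitz.
move=> x; apply/(@cvgrPdist_lt _ _ _ (nbhs x) (nbhs_filter x) g (g x)) => e e0.
apply/nbhs_ballP.
(* [C] may vanish, hence the division by C + 1. *)
have C1 : 0 < C + 1 by lra.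
exists (e / (C + 1)) => /=; first by rewrite divr_gt0.
move=> y; rewrite -ball_normE /= ltr_pdivlMr// => xy.
rewrite ltr_norml; have := gC x y; have := gC y x; rewrite (distrC y x).
have := normr_ge0 (x - y); nra.
Qed.

Lemma kinkZ i e l x : 0 < l -> kink g i e x -> kink g i e (l *: x).
Proof.
move=> l0 kx s s0; have := kx (s / l) (divr_gt0 s0 l0).
have E : s = l * (s / l) by rewrite mulrC divfK// gt_eqF.
have -> : l *: x + s *: unit_vec i = l *: (x + (s / l) *: unit_vec i).
  by rewrite scalerDr scalerA -E.
have -> : l *: x - s *: unit_vec i = l *: (x - (s / l) *: unit_vec i).
  by rewrite scalerBr scalerA -E.
rewrite !gZ ?(ltW l0)// => /(ler_wpM2l (ltW l0)).
by rewrite mulrCA -E; lra.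
Qed.

(** Quantifying over all steps s > 0 presents the set as an intersection of closed conditions. *)
Lemma closed_kink i e : closed (kink g i e).
Proof.
rewrite (_ : kink g i e = \bigcap_(s in [set s : R | 0 < s])
  [set x | e * s <= g (x + s *: unit_vec i) + g (x - s *: unit_vec i) - 2 * g x]).
  apply: closed_bigI => s _.
  apply: (@preimage_closed _ _ (fun x => g (x + s *: unit_vec i)
    + g (x - s *: unit_vec i) - 2 * g x) [set r | e * s <= r]).
    move=> x _.
    have ct (z : V) : {for x, continuous (fun y => g (y + z))}.
      apply: (@continuous_comp _ _ _ (fun y : V => y + z) g).
        by apply: continuousD; [exact: cvg_id|exact: cst_continuous].
      exact: sublinear_continuous.
    have c2 : {for x, continuous (fun y => 2 * g y)}.
      apply: (continuousM (@cst_continuous _ _ (2 : R) x)).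
      exact: sublinear_continuous.
    exact: (continuousB (continuousD (ct _) (ct _)) c2).
  exact: closed_ge.
by apply/seteqP; split => [x kx s|x kx s]; exact: kx.
Qed.

(* The second differences of [g] along the progression telescope. *)
Lemma sum_kink_le i e (K : nat) (s : R) x : 0 < s ->
  \sum_(k < K) (e * \1_(kink g i e) (x + (k%:R * s) *: unit_vec i)) <=
  g (unit_vec i) + g (- unit_vec i).
Proof.
(* The parameter of [p] is real, so that [D 0] can refer to the point one step before [x]. *)
move=> s0; pose p k := x + (k * s) *: unit_vec i.
pose D (k : nat) := g (p k%:R) - g (p (k%:R - 1)).
have pD k : p k + s *: unit_vec i = p (k + 1).
  by rewrite /p -addrA -scalerDl mulrDl mul1r.
have pB k : p k - s *: unit_vec i = p (k - 1).
  by rewrite /p -addrA -scalerBl mulrBl mul1r.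
have step k : (e * s) * \1_(kink g i e) (p k%:R) <= D k.+1 - D k.
  have E : D k.+1 - D k = g (p k%:R + s *: unit_vec i) +
      g (p k%:R - s *: unit_vec i) - 2 * g (p k%:R).
    by rewrite /D pD pB -natr1 addrK; lra.
  rewrite E indicE; case: (boolP (p k%:R \in kink g i e)) => [|_].
    by rewrite inE => /(_ s s0); rewrite mulr1.
  (* Away from the kinks, convexity still makes the second difference nonnegative. *)
  rewrite mulr0; have := gD (p k%:R + s *: unit_vec i) (p k%:R - s *: unit_vec i).
  by rewrite addrACA subrr addr0 -mulr2n -scaler_nat gZ//; lra.
rewrite -(ler_pM2l s0) mulr_sumr.
apply: (@le_trans _ _ (\sum_(0 <= k < K) (D k.+1 - D k))).
  rewrite big_mkord; apply: ler_sum => k _; apply: le_trans (step k).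
  by rewrite mulrA (mulrC s).
rewrite telescope_sumr// /D.
(* The last difference is at most s g (e_i) and the first at least - s g (- e_i); after division by
   [s] the bound depends on neither [K] nor [s]. *)
have := gD (p (K%:R - 1)) (s *: unit_vec i).
have := gD (p 0) (s *: - unit_vec i).
have -> : p 0 + s *: - unit_vec i = p (0 - 1) by rewrite scalerN pB.
have -> : p (K%:R - 1) + s *: unit_vec i = p K%:R by rewrite pD subrK.
by rewrite mulr0n !gZ ?(ltW s0)//; lra.
Qed.

End sublinear_theory.
End sublinear.

Section kinks_null.
Context {R : realType} {n : nat}.
Local Notation V := 'rV[R]_n.+1.
Local Notation T := (caratheodory_type (@leb_outer R n.+1)).
Context (g : V -> R) (sg : sublinear g).

Let cube : set V := [set x | forall i, `|x ord0 i| <= 1].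

Let closed_cube : closed cube.
Proof.
rewrite (_ : cube = \bigcap_(i in [set: 'I_n.+1]) [set x | `|x ord0 i| <= 1]).
  apply: closed_bigI => i _.
  apply: (@preimage_closed _ _ (fun x : V => `|x ord0 i|) [set r | r <= 1]).
    move=> x _; apply: (@continuous_comp _ _ _ (fun y : V => y ord0 i)).
      exact: coord_continuous.
    exact: norm_continuous.
  exact: closed_le.
by apply/seteqP; split => [x kx s _|x kx s]; exact: kx.
Qed.

(** The outer measure retyped on the Carathéodory measurable type, where it is a genuine measure and
    can be integrated against. *)
Definition leb_measure : set T -> \bar R := @leb_outer R n.+1.

HB.instance Definition _ := isMeasure.Build _ T R leb_measure
  leb_outer0 leb_outer_ge0
  (@caratheodory_measure_sigma_additive _ _ (@leb_outer R n.+1)).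

(* The [K] translates of the kinks by multiples of [1 / K] stay in a fixed box
   and cover each point a bounded number of times, uniformly in [K]. *)
Lemma leb_outer_kink i e : 0 < e -> leb_outer (kink g i e `&` cube) = 0%E.
Proof.
move=> e0; set A := kink g i e `&` cube.
have cA : closed A by apply: closedI => //; exact: closed_kink.
(* Translates of the cube by at most one unit have coordinates between -2 and 1, well inside this
   box. *)
pose B : set V := box (\row_(j < n.+1) (- 3)) (\row_(j < n.+1) 3).
have Bfin : (leb_outer B < +oo)%E.
  apply: (@leb_outer_bounded_fin _ _ _ 4) => x xB j; have := xB j.
  by rewrite !mxE ltr_norml; lra.
have Afin : (leb_outer A < +oo)%E.
  apply: (@leb_outer_bounded_fin _ _ _ 2) => x [_ xA] j.
  by rewrite (le_lt_trans (xA j))// ltr1n.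
(* The telescoping bound divided by [e]: the largest possible number of translates through a
   point. *)
pose m := (g (unit_vec i) + g (- unit_vec i)) / e.
have m0 : 0 <= m.
  rewrite divr_ge0 ?(ltW e0)//.
  by have := sg.2 (unit_vec i) (- unit_vec i); rewrite subrr sublinear0.
(* The right-hand side does not depend on [K], which forces the measure of [A] to vanish. *)
have KA (K : nat) : ((K.+1%:R * fine (leb_outer A))%:E <= m%:E * leb_outer B)%E.
  pose s : R := K.+1%:R^-1.
  have s0 : 0 < s by rewrite invr_gt0 ltr0n.
  pose E (k : nat) : set V := [set x | A (x + (k%:R * s) *: unit_vec i)].
  have -> : ((K.+1%:R * fine (leb_outer A))%:E = \sum_(k < K.+1) leb_measure (E k))%E.
    under eq_bigr => k _ do rewrite /leb_measure /E leb_outer_translate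
      -(@fineK _ (leb_outer A)) ?ge0_fin_numE ?leb_outer_ge0//.
    by rewrite sumEFin sumr_const card_ord mulr_natl.
  apply: (@sum_measure_le _ T _ leb_measure) => //.
  - move=> k; apply: leb_measurable_closed.
    rewrite (_ : E k = (fun x : V => x + (k%:R * s) *: unit_vec i) @^-1` A)//.
    apply: (@preimage_closed V V) => //.
    move=> x _; have ci : {for x, continuous (fun y : V => y)} by exact: cvg_id.
    exact: (continuousD ci (@cst_continuous _ _ ((k%:R * s) *: unit_vec i) x)).
  - exact: leb_measurable_box.
  - move=> x; have [xB|xB] := pselect (B x).
      rewrite indicE mem_set// mulr1 /m ler_pdivlMr// mulrC mulr_sumr.
      apply: le_trans (sum_kink_le sg i e K.+1 x s0).
      apply: ler_sum => k _; rewrite ler_pM2l// !indicE ler_nat.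
      by case: (boolP (x \in E k)) => //; rewrite inE => -[xk _]; rewrite mem_set.
    have mB0 : 0 <= m * \1_B x by apply: mulr_ge0.
    rewrite big1// => k _; rewrite indicE memNset// => -[_ xA].
    apply: xB => j; have := xA j; rewrite !mxE ler_norml.
    have k1 : k%:R * s <= 1.
      by rewrite ler_pdivrMr ?ltr0n// mul1r ler_nat ltnW.
    have k0 : 0 <= k%:R * s by rewrite mulr_ge0// ltW.
    by case: (j == i); rewrite ?andbF/= ?mulr1 ?mulr0; lra.
apply/eqP; rewrite -(@fineK _ (leb_outer A)) ?ge0_fin_numE ?leb_outer_ge0//.
have a0 : 0 <= fine (leb_outer A) by rewrite fine_ge0// leb_outer_ge0.
apply/eqP; congr EFin; apply/eqP; rewrite eq_le a0 andbT leNgt; apply/negP => ap.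
move: KA; rewrite -(@fineK _ (leb_outer B)) ?ge0_fin_numE ?leb_outer_ge0//.
have b0 : 0 <= fine (leb_outer B) by rewrite fine_ge0// leb_outer_ge0.
set a := fine (leb_outer A) in ap *; set b := fine (leb_outer B) in b0 *.
have q0 : 0 <= m * b / a by apply: divr_ge0; [exact: mulr_ge0|exact: ltW].
move=> /(_ (Num.bound (m * b / a))); rewrite -EFinM lee_fin -ler_pdivlMr//.
by rewrite leNgt (lt_trans (archi_boundP q0))// ltr_nat.
Qed.

Lemma leb_outer_bigcup0 (F : nat -> set V) :
  (forall k, leb_outer (F k) = 0%E) -> leb_outer (\bigcup_k F k) = 0%E.
Proof.
move=> F0; apply/eqP; rewrite eq_le leb_outer_ge0 andbT.
apply: le_trans (leb_outer_sigma_subadditive F) _.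
by rewrite eseries0.
Qed.

(** Kinks are invariant under positive scaling, so the cone over those on the sphere consists of
    kinks lying in the cube. *)
Lemma sph_measure_kinks : sph_measure (kinks g : set (@SphT R n.+1)) = 0%E.
Proof.
apply/eqP; rewrite mule_eq0; apply/orP; right.
rewrite eq_le leb_outer_ge0 andbT.
(* [inord] lets the coordinate range over all naturals, so the same countable union lemma serves
   twice; repeated coordinates do no harm. *)
pose F j k := kink g (inord j) k.+1%:R^-1 `&` cube.
have <- : leb_outer (\bigcup_j \bigcup_k F j k) = 0%E.
  do 2!(apply: leb_outer_bigcup0 => ?).
  by apply: leb_outer_kink; rewrite invr_gt0 ltr0n.
apply: le_leb_outer => x [r [u [/andP[r0 r1] [i _ [k _ uk]] u1 ->]]].
exists i => //; exists k => //; split; first by rewrite inord_val; exact: kinkZ.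
move=> j; rewrite mxE normrM gtr0_norm//.
have := sphere_coord_le1 j u1; have := normr_ge0 (u ord0 j); nra.
Qed.

Lemma measurable_kinks : measurable (kinks g : set (@BorT R n.+1)).
Proof.
apply: fin_bigcup_measurable => // i _; apply: bigcupT_measurable => k.
by apply: measurable_closed_BorT; exact: closed_kink.
Qed.

End kinks_null.

(** Otherwise the normalized vector - x would be the pole of a closed hemisphere containing
    [Omega]. *)
Lemma sphere_halfspace_nonempty (R : realType) n (Omega : set 'rV[R]_n.+1) :
  ~ (exists v, sphere v /\ forall u, Omega u -> 0 <= dotp u v) ->
  forall x : 'rV[R]_n.+1, x != 0 -> exists2 v, Omega v & 0 < dotp v x.
Proof.
move=> hemi x x0; apply: contrapT => nx; apply: hemi.
exists (- ((Num.sqrt (dotp x x))^-1 *: x)); split.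
  have := sphere_normalize x0; rewrite /sphere /= dotpNl dotpC dotpNl opprK.
  by [].
move=> u Ou; rewrite dotpC dotpNl dotpZl dotpC oppr_ge0 pmulr_rle0; last first.
  by rewrite invr_gt0 sqrtr_gt0 dotp_gt0.
by rewrite leNgt; apply/negP => ux; apply: nx; exists u.
Qed.

Lemma continuous_dotpl {R : realType} {n : nat} (x : 'rV[R]_n) :
  continuous (fun v : 'rV[R]_n => dotp v x).
Proof.
apply: continuous_sumr => i v.
have ci : {for v, continuous (fun y : 'rV[R]_n => y ord0 i)} by exact: coord_continuous.
exact: (continuousM ci (@cst_continuous _ _ (x ord0 i) v)).
Qed.

(** * Polar bodies of convex hulls *)

Section support_of_weighted_set.
Context {R : realType} {n : nat}.
Local Notation V := 'rV[R]_n.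
Implicit Types (S : set V) (c : V -> R) (x u v : V).

(** The set [S] is a parameter because the measurability of the maximizer map compares the suprema
    over [Omega] and over its closed subsets. *)
Definition wsup S c x : R := sup [set c v * dotp v x | v in S].

Definition wmax S c x v := S v /\ forall w, S w -> c w * dotp w x <= c v * dotp v x.

Lemma wmax_exists S c x : S !=set0 -> compact S -> {within S, continuous c} ->
  exists v, wmax S c x v.
Proof.
move=> S0 cS cc.
have [//|//||v vS vm] := @EVT_max_rV R n (fun v => c v * dotp v x) S.
  have cd : {within S, continuous (fun v => dotp v x)}.
    by apply: continuous_subspaceT; exact: continuous_dotpl.
  by move=> v; apply: cvgM; [exact: cc|exact: cd].
by exists v; rewrite inE in vS; split => // w Sw; apply: vm; rewrite inE.
Qed.

Lemma wsupE S c x v : wmax S c x v -> wsup S c x = c v * dotp v x.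
Proof.
move=> [Sv vm]; apply/eqP; rewrite eq_le; apply/andP; split.
  by apply: ge_sup; [exists (c v * dotp v x), v|move=> _ [w Sw <-]; exact: vm].
apply: ub_le_sup; last by exists v.
by exists (c v * dotp v x) => _ [w Sw <-]; exact: vm.
Qed.

Context S c (S0 : S !=set0) (cS : compact S) (cc : {within S, continuous c}).

Lemma wsup_ge x v : S v -> c v * dotp v x <= wsup S c x.
Proof.
by have [w ww] := wmax_exists x S0 cS cc; rewrite (wsupE ww); exact: ww.2.
Qed.

Lemma wsup_attained x : exists2 v, S v & wsup S c x = c v * dotp v x.
Proof.
by have [w ww] := wmax_exists x S0 cS cc; exists w; [exact: ww.1|exact: wsupE].
Qed.

Lemma wsup_le x (M : R) : (forall v, S v -> c v * dotp v x <= M) -> wsup S c x <= M.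
Proof. by move=> SM; have [v Sv ->] := wsup_attained x; exact: SM. Qed.

Lemma wsup_sublinear : sublinear (wsup S c).
Proof.
split=> [l x l0|x y]; last first.
  by apply: wsup_le => v Sv; rewrite dotpDr mulrDr lerD// wsup_ge.
apply/eqP; rewrite eq_le; apply/andP; split.
  by apply: wsup_le => v Sv; rewrite dotpZr mulrCA ler_wpM2l// wsup_ge.
have [v Sv ->] := wsup_attained x.
by rewrite mulrCA -dotpZr wsup_ge.
Qed.

(** Points of the generating set are one-term convex combinations; conversely, a linear form bounded
    by 1 at the generators is bounded by 1 on their convex combinations. *)
Lemma polar_rho_hullE : polar (rho_hull S c) = [set x | wsup S c x <= 1].
Proof.
apply/seteqP; split => [x xP|x x1 y [k [lam [p [lam0 lam1 pS ->]]]]].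
  apply: wsup_le => v Sv; rewrite -dotpZl dotpC; apply: xP.
  exists 1%N, (fun=> 1), (fun=> c v *: v).
  by split => // [|i|]; rewrite ?big_ord1 ?scale1r//; exists v.
have -> : dotp x (\sum_(i < k) lam i *: p i) = \sum_(i < k) lam i * dotp x (p i).
  elim/big_rec2: _ => [|i y1 y2 _ <-]; last by rewrite dotpDr dotpZr.
  by rewrite dotpC -(scale0r (0 : V)) dotpZl mul0r.
rewrite -lam1; apply: ler_sum => i _; rewrite ler_piMr//.
have [v Sv <-] := pS i; rewrite dotpC dotpZl.
exact: le_trans (wsup_ge _ Sv) x1.
Qed.

Lemma radial_polarE x : 0 < wsup S c x ->
  radial (polar (rho_hull S c)) x = (wsup S c x)^-1.
Proof.
move=> gx; rewrite polar_rho_hullE /radial.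
have E (l : R) : 0 <= l -> (wsup S c (l *: x) <= 1) = (l <= (wsup S c x)^-1).
  by move=> l0; rewrite wsup_sublinear.1// -ler_pdivlMr// mul1r.
apply/eqP; rewrite eq_le; apply/andP; split.
  apply: ge_sup; first by exists 0; split => //=; rewrite E// invr_ge0 ltW.
  by move=> l [l0 /=]; rewrite E.
apply: ub_le_sup.
  by exists (wsup S c x)^-1 => l [l0 /=]; rewrite E.
have i0 : 0 <= (wsup S c x)^-1 by rewrite invr_ge0 ltW.
by split => //=; rewrite E.
Qed.

End support_of_weighted_set.

(* [wsup Omega rho] is the support function of [rho_hull Omega rho], that is, the
   gauge of its polar body. *)
Section polar_body.
Context {R : realType} {n : nat}.
Local Notation V := 'rV[R]_n.+1.
Context (Omega : set V) (rho : V -> R).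
Hypotheses (cO : closed Omega) (Osph : Omega `<=` sphere).
Hypothesis hemi : ~ (exists v, sphere v /\ forall u, Omega u -> 0 <= dotp u v).
Hypotheses (rho_gt0 : forall u, Omega u -> 0 < rho u)
  (crho : {within Omega, continuous rho}).
Implicit Types (x u v : V).

Local Notation g := (wsup Omega rho).
Local Notation M := (polar (rho_hull Omega rho)).

Lemma compact_Omega : compact Omega.
Proof. by apply: (subclosed_compact _ compact_sphere). Qed.

Lemma Omega_nonempty : Omega !=set0.
Proof.
have e0 : delta_mx ord0 ord0 != 0 :> V.
  by rewrite -dotp_eq0 dotp_delta mxE !eqxx oner_eq0.
by have [v Ov _] := sphere_halfspace_nonempty hemi e0; exists v.
Qed.

Let On0 := Omega_nonempty.
Let cptO := compact_Omega.

Lemma gauge_gt0 x : x != 0 -> 0 < g x.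
Proof.
move=> x0; have [v Ov vx] := sphere_halfspace_nonempty hemi x0.
by apply: lt_le_trans (wsup_ge On0 cptO crho x Ov); rewrite mulr_gt0// rho_gt0.
Qed.

Lemma gauge_bounds : exists m M, [/\ 0 < m, m <= M &
  forall u, sphere u -> m <= g u <= M].
Proof.
have sg := wsup_sublinear On0 cptO crho.
have cg : {within sphere, continuous g}.
  by apply: continuous_subspaceT; exact: sublinear_continuous sg.
have s0 : @sphere R n.+1 !=set0 by have [v Ov] := On0; exists v; exact: Osph.
have [a aS am] := EVT_min_rV s0 compact_sphere cg.
have [b bS bm] := EVT_max_rV s0 compact_sphere cg.
exists (g a), (g b); split; last by move=> u u1; rewrite am ?bm ?inE.
- by apply/gauge_gt0/sphere_neq0; rewrite inE in aS.
- exact: am.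
Qed.

Lemma maximizer_dotp_gt0 u v : sphere u -> Omega v -> g u = rho v * dotp v u ->
  0 < dotp v u.
Proof.
move=> u1 Ov gv; have := gauge_gt0 (sphere_neq0 u1).
by rewrite gv pmulr_rgt0// rho_gt0.
Qed.

(** A maximizer [v] makes [rho v *: v] a subgradient of the gauge at [u], and there is only one off
    the kinks. *)
Lemma maximizer_unique u v a : ~ kinks g u -> Omega v -> g u = rho v * dotp v u ->
  (forall y, dotp a y <= g y) -> dotp a u = g u -> a = rho v *: v.
Proof.
move=> uN Ov gv ag au; apply: (unique_subgradient uN) => //.
  by move=> y; rewrite dotpZl; exact: wsup_ge.
by rewrite dotpZl.
Qed.

(** The gauge is at least some m > 0 on the sphere, so the polar body lies in the ball of radius 1 /
    m. This boundedness gives the real supremum in [support] its meaning. *)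
Lemma support_has_sup v : sphere v -> has_sup [set dotp x v | x in M].
Proof.
move=> v1; rewrite polar_rho_hullE//; split.
  exists (dotp 0 v), 0 => //=.
  by rewrite (sublinear0 (wsup_sublinear On0 cptO crho)).
have [m [m' [m0 _ gm]]] := gauge_bounds.
(* This bound comes from 2 x.v <= |x|^2 + |v|^2 with |x| <= 1 / m and |v| = 1. *)
exists (m ^- 2 + 1) => _ [x /= gx <-].
have [->|x0] := eqVneq x 0.
  rewrite -(scale0r (0 : V)) dotpZl mul0r addr_ge0// invr_ge0 exprn_ge0// ltW//.
have d0 : 0 < dotp x x by rewrite dotp_gt0.
pose r := Num.sqrt (dotp x x).
have r0 : 0 < r by rewrite sqrtr_gt0.
have : m <= r^-1 * g x.
  rewrite -(wsup_sublinear On0 cptO crho).1 ?invr_ge0 ?(ltW r0)//.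
  by have /andP[] := gm _ (sphere_normalize x0).
rewrite mulrC ler_pdivlMr// => mr.
have mr1 : m * r <= 1 by apply: le_trans gx.
have rr : r ^+ 2 = dotp x x by rewrite sqr_sqrtr ?dotp_ge0.
have mr2 : r ^+ 2 <= m ^- 2.
  rewrite -div1r ler_pdivlMr ?exprn_gt0// -exprMn mulrC expr_le1//.
  by rewrite mulr_ge0// ltW.
have := dotp_le_sqr x v; rewrite v1 -rr; nra.
Qed.

(** Every x in the polar body satisfies rho(v) (v . x) <= g(x) <= 1, with equality at the boundary
    point u / g(u); both sides equal 1 / rho(v). *)
Lemma support_maximizer u v : sphere u -> Omega v -> g u = rho v * dotp v u ->
  radial M u * dotp u v = Defs.support M v.
Proof.
move=> u1 Ov gv; have g0 := gauge_gt0 (sphere_neq0 u1).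
rewrite radial_polarE//; apply/eqP; rewrite eq_le; apply/andP; split.
  rewrite -dotpZl; apply: ub_le_sup; first by have [] := support_has_sup (Osph Ov).
  exists ((g u)^-1 *: u) => //; rewrite polar_rho_hullE//=.
  by rewrite (wsup_sublinear On0 cptO crho).1 ?invr_ge0 ?(ltW g0)// mulVf ?gt_eqF.
apply: ge_sup; first by have [] := support_has_sup (Osph Ov).
rewrite polar_rho_hullE// => _ [x /= gx <-].
have := le_trans (wsup_ge On0 cptO crho x Ov) gx.
have -> : (g u)^-1 * dotp u v = (rho v)^-1.
  rewrite gv (dotpC u) invfM mulrAC -mulrA divff ?mulr1//.
  by rewrite gt_eqF//; exact: maximizer_dotp_gt0 gv.
by rewrite -div1r ler_pdivlMr ?rho_gt0// mulrC dotpC.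
Qed.

(* An outer normal [v] at the boundary point in direction [u] gives the subgradient
   [h^-1 *: v] of the gauge at [u], where [h] is the support number. *)
Lemma outer_normal_maximizer u v w : ~ kinks g u -> sphere u -> sphere v ->
  Omega w -> g u = rho w * dotp w u ->
  radial M u * dotp u v = Defs.support M v -> v = w.
Proof.
move=> uN u1 v1 Ow gw; have g0 := gauge_gt0 (sphere_neq0 u1).
rewrite radial_polarE// => E; set h := Defs.support M v in E.
have sg := wsup_sublinear On0 cptO crho.
(* By homogeneity, the bound by [h] on the body becomes a bound on the whole space. *)
have hg x : dotp x v <= h * g x.
  have [->|x0] := eqVneq x 0.
    by rewrite -(scale0r (0 : V)) dotpZl mul0r scale0r (sublinear0 sg) mulr0.
  have gx := gauge_gt0 x0; rewrite -ler_pdivrMr// mulrC -dotpZl.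
  apply: ub_le_sup; first by have [] := support_has_sup v1.
  exists ((g x)^-1 *: x) => //; rewrite polar_rho_hullE//=.
  by rewrite sg.1 ?invr_ge0 ?(ltW gx)// mulVf ?gt_eqF.
(* At x = v the inequality reads 1 <= h g(v), with g(v) > 0. *)
have h0 : 0 < h.
  have := hg v; rewrite v1 => hv; have := gauge_gt0 (sphere_neq0 v1); nra.
have : h^-1 *: v = rho w *: w.
  apply: (maximizer_unique uN Ow gw) => [y|].
    by rewrite dotpZl mulrC dotpC ler_pdivrMr// mulrC.
  rewrite dotpZl dotpC -(mulVKf (lt0r_neq0 g0) (dotp u v)) E mulrCA mulVf ?mulr1//.
  by rewrite gt_eqF.
apply: sphere_scale_eq => //; first exact: Osph.
- by rewrite invr_gt0.
- exact: rho_gt0.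
Qed.

End polar_body.

(** * Estimates for exponentials and powers *)

Lemma expR_taylor1 (R : realType) (y : R) : `|y| <= 2^-1 ->
  `|expR y - 1 - y| <= 2 * y ^+ 2.
Proof.
rewrite ler_norml => /andP[y1 y2].
have A := expR_ge1Dx y; have B := expR_ge1Dx (- y).
have AB : expR y * expR (- y) = 1 by rewrite -expRD subrr expR0.
have A0 := expR_gt0 y.
have A1 : expR y * (1 - y) <= 1 by move: B; rewrite -(ler_pM2l A0) AB.
(* The right-hand side equals 1 + y^2 (1 - 2 y), which is at least 1 since y <= 1 / 2. *)
have : expR y * (1 - y) <= (1 + y + 2 * y ^+ 2) * (1 - y).
  by apply: le_trans A1 _; nra.
rewrite ler_pM2r; last by lra.
move=> A2; rewrite ler_norml; apply/andP; split; last by lra.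
by have := sqr_ge0 y; lra.
Qed.

Lemma powR_expR (R : realType) (x q : R) : 0 < x -> x `^ q = expR (q * ln x).
Proof. by move=> x0; rewrite /powR gt_eqF. Qed.

Lemma powR_bounded (R : realType) (m M p : R) : 0 < m ->
  exists2 B, 0 < B & forall x, m <= x <= M -> x `^ p <= B.
Proof.
move=> m0; exists (expR (`|p| * (`|ln m| + `|ln M|))); first exact: expR_gt0.
move=> x /andP[mx xM]; have x0 : 0 < x by exact: lt_le_trans mx.
rewrite powR_expR// ler_expR (le_trans (ler_norm _))// normrM ler_wpM2l//.
have l1 : ln m <= ln x by rewrite ler_ln ?posrE.
have l2 : ln x <= ln M by rewrite ler_ln ?posrE// (lt_le_trans x0).
have := ler_norm (ln M); have := ler_norm (- ln m); rewrite normrN.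
have := normr_ge0 (ln M); have := normr_ge0 (ln m).
by rewrite ler_norml => *; apply/andP; split; lra.
Qed.

Lemma within_continuous_bounded (R : realType) n (S : set 'rV[R]_n)
    (h : 'rV[R]_n -> R) :
  S !=set0 -> compact S -> {within S, continuous h} ->
  exists2 M, 0 <= M & forall v, S v -> `|h v| <= M.
Proof.
move=> S0 cS ch; have [a aS am] := EVT_min_rV S0 cS ch.
have [b bS bm] := EVT_max_rV S0 cS ch.
exists (`|h a| + `|h b|); first exact: addr_ge0.
move=> v Sv; have := am v; have := bm v; rewrite !inE => /(_ Sv) vb /(_ Sv) av.
have := ler_norm (h b); have := ler_norm (- h a); rewrite normrN.
have := normr_ge0 (h b); have := normr_ge0 (h a).
by rewrite ler_norml => *; apply/andP; split; lra.
Qed.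

(** * Logarithmic families *)

Section log_family_gauge.
Context {R : realType} {n : nat}.
Local Notation V := 'rV[R]_n.+1.
Context (Omega : set V) (rho0 f : V -> R) (rho : R -> V -> R).
Hypotheses (cO : closed Omega) (Osph : Omega `<=` sphere).
Hypothesis hemi : ~ (exists v, sphere v /\ forall u, Omega u -> 0 <= dotp u v).
Hypotheses (rho0_gt0 : forall u, Omega u -> 0 < rho0 u)
  (crho0 : {within Omega, continuous rho0}) (cf : {within Omega, continuous f}).
Hypothesis lf : log_family Omega rho0 f rho.
Implicit Types (x u v w a : V) (t : R).

Let On0 := Omega_nonempty hemi.
Let cptO := compact_Omega cO Osph.

Lemma ln_gauge_ge (c : V -> R) u v : (forall u, Omega u -> 0 < c u) ->
  {within Omega, continuous c} -> Omega v -> 0 < dotp v u ->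
  ln (c v) + ln (dotp v u) <= ln (wsup Omega c u).
Proof.
move=> c0 cc Ov vu; rewrite -lnM ?posrE ?c0//.
have cv : 0 < c v * dotp v u by rewrite mulr_gt0 ?c0.
have cg := wsup_ge On0 cptO cc u Ov.
by rewrite ler_ln ?posrE// (lt_le_trans cv).
Qed.

Lemma ln_gauge_attained (c : V -> R) u : (forall u, Omega u -> 0 < c u) ->
  {within Omega, continuous c} -> sphere u ->
  exists v, [/\ Omega v, 0 < dotp v u & ln (wsup Omega c u) = ln (c v) + ln (dotp v u)].
Proof.
move=> c0 cc u1; have [v Ov E] := wsup_attained On0 cptO cc u.
have vu := maximizer_dotp_gt0 cO Osph hemi c0 cc u1 Ov E.
by exists v; rewrite E -lnM ?posrE ?c0.
Qed.

(** The logarithm of the gauge is the maximum of ln c(v) + ln (v . u) over the v with v . u > 0;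
    maxima of functions that differ by at most [k] differ by at most [k]. *)
Lemma ln_gauge_dist (c c' : V -> R) k u :
  (forall u, Omega u -> 0 < c u) -> (forall u, Omega u -> 0 < c' u) ->
  {within Omega, continuous c} -> {within Omega, continuous c'} ->
  (forall v, Omega v -> `|ln (c' v) - ln (c v)| <= k) -> sphere u ->
  `|ln (wsup Omega c' u) - ln (wsup Omega c u)| <= k.
Proof.
move=> c0 c'0 cc cc' cck u1.
have [v [Ov vu E]] := ln_gauge_attained c'0 cc' u1.
have [w [Ow wu F]] := ln_gauge_attained c0 cc u1.
have := ln_gauge_ge c0 cc Ov vu; have := ln_gauge_ge c'0 cc' Ow wu.
have := cck v Ov; have := cck w Ow; rewrite !ler_norml E F; lra.
Qed.

Lemma log_family_expansion e : 0 < e ->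
  exists2 d, 0 < d & forall t, 0 < `|t| < d ->
    [/\ forall u, Omega u -> 0 < rho t u, {within Omega, continuous (rho t)} &
        forall u, Omega u -> `|ln (rho t u) - ln (rho0 u) - t * f u| <= e * `|t|].
Proof.
move=> e0; have [d1 [d10 [err [_ lf1 lf2]]]] := lf.
have [d2 [d20 lf3]] := lf2 e e0.
exists (Num.min d1 d2); first by rewrite lt_min d10.
move=> t /andP[t0]; rewrite lt_min => /andP[td1 td2].
have [rt crt _ E] := lf1 t td1; split => // u Ou; rewrite E//.
have -> : ln (rho0 u) + t * f u + err t u - ln (rho0 u) - t * f u = err t u by lra.
have := lf3 t; rewrite t0 td2 => /(_ isT u Ou)/ltW.
by rewrite normrM normfV ler_pdivrMr.
Qed.

Lemma log_family_lipschitz :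
  exists C d, [/\ 0 < C, 0 < d & forall t, 0 < `|t| < d ->
    [/\ forall u, Omega u -> 0 < rho t u, {within Omega, continuous (rho t)} &
        forall u, Omega u -> `|ln (rho t u) - ln (rho0 u)| <= C * `|t|]].
Proof.
have [d d0 H] := log_family_expansion (@ltr01 R).
have [F F0 fF] := within_continuous_bounded On0 cptO cf.
(* [F] bounds [f], and 1 bounds the error term divided by t. *)
exists (F + 1), d; split => //; first by rewrite ltr_wpDl.
move=> t /H[rt crt E]; split => // u Ou.
rewrite -(subrK (t * f u) (_ - _)) (le_trans (ler_normD _ _))//.
rewrite mulrDl addrC lerD ?E// normrM mulrC ler_wpM2r//.
exact: fF.
Qed.

Let compact_far a e : compact (Omega `&` [set v | e <= `|f v - f a|]).
Proof.
have cr : closed [set r : R | e <= `|r - f a|].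
  apply: (@preimage_closed _ _ (fun r : R => `|r - f a|) [set r | e <= r]).
    move=> r _; apply: (@continuous_comp _ _ _ (fun r : R => r - f a)).
      by apply: continuousB; [exact: cvg_id|exact: cst_continuous].
    exact: norm_continuous.
  exact: closed_ge.
have /continuous_closedP/(_ _ cr)/closed_subspaceP[W cW WO] := cf.
have -> : Omega `&` [set v | e <= `|f v - f a|] = Omega `&` W.
  by rewrite setIC [RHS]setIC WO.
apply: (subclosed_compact _ cptO); first exact: closedI.
exact: subIsetl.
Qed.

(* Danskin's theorem: any maximizer for [rho t] is close to the unique maximizer
   [a] for [rho0], so that [f] takes almost the same value at both. *)
Lemma ln_gauge_deriv u a e : sphere u -> Omega a ->
  wsup Omega rho0 u = rho0 a * dotp a u ->
  (forall w, Omega w -> wsup Omega rho0 u = rho0 w * dotp w u -> w = a) ->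
  0 < e ->
  exists2 d, 0 < d & forall t, 0 < `|t| < d ->
    `|ln (wsup Omega (rho t) u) - ln (wsup Omega rho0 u) - t * f a| <= e * `|t|.
Proof.
move=> u1 Oa ga ua e0; have e20 : 0 < e / 2 by rewrite divr_gt0.
have au := maximizer_dotp_gt0 cO Osph hemi rho0_gt0 crho0 u1 Oa ga.
pose U := Omega `&` [set v | e / 2 <= `|f v - f a|].
have [gap gap0 gapU] : exists2 gap, 0 < gap & forall v, U v -> 0 < dotp v u ->
    ln (rho0 v) + ln (dotp v u) <= ln (wsup Omega rho0 u) - gap.
  (* The gap separates the compact set [U] from the unique maximizer. If no point of [U] has
     positive product with [u], any gap will do and 1 is taken. *)
  have [U0|U0] := pselect (U !=set0); last by exists 1 => // v Uv; case: U0; exists v.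
  have cU : {within U, continuous rho0}.
    by apply: continuous_subspaceW crho0; exact: subIsetl.
  have cptU : compact U by exact: compact_far.
  have [w [Uw wm]] := wmax_exists u U0 cptU cU.
  have wg : rho0 w * dotp w u < wsup Omega rho0 u.
    rewrite lt_neqAle (wsup_ge On0 cptO crho0 u Uw.1) andbT.
    apply/eqP => /esym/(ua w Uw.1) wa; have := Uw.2.
    by rewrite /= wa subrr normr0; lra.
  have lnU v : U v -> 0 < dotp v u ->
      0 < rho0 w * dotp w u /\
      ln (rho0 v) + ln (dotp v u) <= ln (rho0 w * dotp w u).
    move=> Uv vu; have r0 := rho0_gt0 Uv.1.
    have vw := wm v Uv; have v0 : 0 < rho0 v * dotp v u by exact: mulr_gt0.
    split; first exact: lt_le_trans vw.
    by rewrite -lnM ?posrE// ler_ln ?posrE// (lt_le_trans v0).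
  have [s0|s0] := ltP 0 (rho0 w * dotp w u).
    exists (ln (wsup Omega rho0 u) - ln (rho0 w * dotp w u)).
      by rewrite subr_gt0 ltr_ln ?posrE// (lt_trans s0).
    by move=> v Uv vu; have := (lnU v Uv vu).2; lra.
  by exists 1 => // v Uv vu; have := (lnU v Uv vu).1; lra.
have [C [d1 [C0 d10 lip]]] := log_family_lipschitz.
have [d2 d20 ex] := log_family_expansion e20.
(* Both ln rho_t(v) and ln g_t(u) move by at most C |t|, so for |t| < d3 no maximizer at time t can
   lie in [U]. *)
pose d3 := gap / (2 * C).
have d30 : 0 < d3 by rewrite divr_gt0// mulr_gt0.
exists (Num.min d1 (Num.min d2 d3)); first by rewrite !lt_min d10 d20.
move=> t; rewrite !lt_min => /and4P[t0 td1 td2 td3].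
have /lip[rt crt lipt] : 0 < `|t| < d1 by rewrite t0.
have /ex[_ _ ext] : 0 < `|t| < d2 by rewrite t0.
have gt := ln_gauge_dist rho0_gt0 rt crho0 crt lipt u1.
have [v [Ov vu gv]] := ln_gauge_attained rt crt u1.
have fv : `|f v - f a| < e / 2.
  rewrite ltNge; apply/negP => fv; have := gapU v (conj Ov fv) vu.
  move: gt (lipt v Ov); rewrite gv !ler_norml.
  by move: td3; rewrite /d3 ltr_pdivlMr ?mulr_gt0//; nra.
(* Testing [v] at time 0 bounds the increment above by that of ln rho_t(v); testing [a] at time t
   bounds it below by that of ln rho_t(a). *)
have v0 := ln_gauge_ge rho0_gt0 crho0 Ov vu.
have a0 := ln_gauge_ge rt crt Oa au.
have ga' : ln (wsup Omega rho0 u) = ln (rho0 a) + ln (dotp a u).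
  by rewrite ga lnM ?posrE ?rho0_gt0.
have tf : `|t * f v - t * f a| <= e / 2 * `|t|.
  by rewrite -mulrBr normrM mulrC ler_wpM2r// ltW.
by move: (ext v Ov) (ext a Oa) tf; rewrite gv !ler_norml; lra.
Qed.

Section power.
Variable q : R.
Local Notation G t u := ((wsup Omega (rho t) u)^-1 `^ q).
Local Notation G0 u := ((wsup Omega rho0 u)^-1 `^ q).

Lemma gauge_powerE (c : V -> R) u : (forall u, Omega u -> 0 < c u) ->
  {within Omega, continuous c} -> sphere u ->
  (wsup Omega c u)^-1 `^ q = expR (- q * ln (wsup Omega c u)).
Proof.
move=> c0 cc u1.
have g0 := gauge_gt0 cO Osph hemi c0 cc (sphere_neq0 u1).
by rewrite powR_expR ?invr_gt0// lnV ?posrE// mulrN mulNr.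
Qed.

(** Supplies the constant that dominates the difference quotients. For |y| <= k <= 1 / 2 the Taylor
    estimate gives |exp y - 1| <= k + 2 k^2 <= 2 k. *)
Lemma gauge_power_quotient_bounded :
  exists d B, [/\ 0 < d, 0 <= B & forall t u, 0 < `|t| < d -> sphere u ->
    `|(G t u - G0 u) / t| <= B].
Proof.
have [C [d1 [C0 d10 lip]]] := log_family_lipschitz.
have [m [M [m0 mM gm]]] := gauge_bounds cO Osph hemi rho0_gt0 crho0.
have [B B0 GB] := @powR_bounded R M^-1 m^-1 q ltac:(by rewrite invr_gt0 (lt_le_trans m0)).
pose K := `|q| * C; have K0 : 0 <= K by rewrite mulr_ge0// ltW.
pose d2 := (2 * (K + 1))^-1.
have d20 : 0 < d2 by rewrite invr_gt0; nra.
exists (Num.min d1 d2), (B * (2 * K)); split.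
- by rewrite lt_min d10.
- by rewrite mulr_ge0 ?mulr_ge0// ltW.
move=> t u; rewrite lt_min => /and3P[t0 td1 td2] u1.
have /lip[rt crt lipt] : 0 < `|t| < d1 by rewrite t0.
have gt := ln_gauge_dist rho0_gt0 rt crho0 crt lipt u1.
rewrite normrM normfV ler_pdivrMr// !gauge_powerE//.
set x := ln (wsup Omega (rho t) u) in gt *; set x0 := ln _ in gt *.
have -> : - q * x = - q * x0 + - q * (x - x0) by lra.
rewrite expRD -[X in _ - X]mulr1 -mulrBr normrM -mulrA.
have y1 : `|- q * (x - x0)| <= K * `|t|.
  by rewrite normrM normrN /K -mulrA ler_wpM2l.
have y2 : K * `|t| <= 2^-1.
  move: td2; rewrite /d2 -div1r ltr_pdivlMr; last by nra.
  by have := ltW t0; nra.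
apply: ler_pM => //.
  rewrite ger0_norm ?expR_ge0// -gauge_powerE//; apply: GB.
  have /andP[g1 g2] := gm u u1.
  have g0 : 0 < wsup Omega rho0 u by exact: lt_le_trans g1.
  by rewrite !lef_pV2 ?posrE ?g1 ?g2// (lt_le_trans m0).
have := expR_taylor1 (le_trans y1 y2).
set y := - q * (x - x0) in y1 *; set k := K * `|t| in y1 y2 *.
rewrite -(mulrA 2) -/k.
have y3 : y ^+ 2 <= k * k by rewrite -real_normK ?num_real// expr2 ler_pM.
by move: y1; rewrite !ler_norml => /andP[? ?] /andP[? ?]; apply/andP; split; nra.
Qed.

Lemma gauge_power_deriv u a e : sphere u -> Omega a ->
  wsup Omega rho0 u = rho0 a * dotp a u ->
  (forall w, Omega w -> wsup Omega rho0 u = rho0 w * dotp w u -> w = a) ->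
  0 < e ->
  exists2 d, 0 < d & forall t, 0 < `|t| < d ->
    `|(G t u - G0 u) / t - (- q * f a * G0 u)| <= e.
Proof.
move=> u1 Oa ga ua e0; set E0 := G0 u.
have E00 : 0 < E0 by rewrite /E0 gauge_powerE ?expR_gt0.
have [C [d1 [C0 d10 lip]]] := log_family_lipschitz.
(* Chosen so that the error in the logarithmic derivative, multiplied by E0 (|q| + 1), is e / 2
   times |t|. *)
pose e1 := e / (2 * E0 * (`|q| + 1)).
have q1 : 0 < `|q| + 1 by rewrite ltr_wpDl.
have e10 : 0 < e1 by rewrite divr_gt0// mulr_gt0// mulr_gt0.
have [d2 d20 der] := ln_gauge_deriv u1 Oa ga ua e10.
pose K := `|q| * C; have K0 : 0 <= K by rewrite mulr_ge0// ltW.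
pose d3 := (2 * (K + 1))^-1.
have d30 : 0 < d3 by rewrite invr_gt0; nra.
(* [d3] keeps the exponent below 1 / 2; [d4] makes the quadratic Taylor remainder at most e / 2
   times |t|. *)
pose d4 := e / (4 * E0 * (K ^+ 2 + 1)).
have K1 : 0 < K ^+ 2 + 1 by rewrite ltr_wpDl ?sqr_ge0.
have d40 : 0 < d4 by rewrite divr_gt0// mulr_gt0// mulr_gt0.
exists (Num.min (Num.min d1 d2) (Num.min d3 d4)).
  by rewrite !lt_min d10 d20 d30.
move=> t; rewrite !lt_min => /andP[t0 /andP[/andP[td1 td2] /andP[td3 td4]]].
have /lip[rt crt lipt] : 0 < `|t| < d1 by rewrite t0.
have /der dert : 0 < `|t| < d2 by rewrite t0.
have gt := ln_gauge_dist rho0_gt0 rt crho0 crt lipt u1.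
have tn0 : t != 0 by rewrite -normr_gt0.
rewrite -[X in `|X|](mulfK tn0) normrM normfV ler_pdivrMr// mulrBl divfK//.
rewrite gauge_powerE// {1}/E0 (gauge_powerE rho0_gt0 crho0 u1).
set x := ln (wsup Omega (rho t) u) in gt dert *.
set x0 := ln (wsup Omega rho0 u) in gt dert *.
have -> : - q * x = - q * x0 + - q * (x - x0) by lra.
rewrite expRD -gauge_powerE// -/E0.
set y := - q * (x - x0).
have -> : E0 * expR y - E0 - - q * f a * E0 * t =
    E0 * ((expR y - 1 - y) + - q * (x - x0 - t * f a)) by rewrite /y; lra.
rewrite normrM gtr0_norm//.
have y1 : `|y| <= K * `|t| by rewrite normrM normrN /K -mulrA ler_wpM2l.
have y2 : K * `|t| <= 2^-1.
  move: td3; rewrite /d3 -div1r ltr_pdivlMr; last by nra.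
  by have := ltW t0; nra.
have y3 : y ^+ 2 <= K ^+ 2 * `|t| ^+ 2.
  by rewrite -real_normK ?num_real// -exprMn !expr2 ler_pM.
have T1 : E0 * `|expR y - 1 - y| <= e / 2 * `|t|.
  apply: (@le_trans _ _ (E0 * (2 * (K ^+ 2 * `|t| ^+ 2)))).
    rewrite ler_pM2l//; apply: le_trans (expR_taylor1 (le_trans y1 y2)) _.
    by rewrite ler_pM2l.
  have : `|t| * (4 * E0 * (K ^+ 2 + 1)) <= e.
    by rewrite -ler_pdivlMr ?(ltW td4)// mulr_gt0// mulr_gt0.
  move=> /(ler_wpM2r (normr_ge0 t)) H; rewrite expr2.
  have := mulr_ge0 (ltW E00) (mulr_ge0 (normr_ge0 t) (normr_ge0 t)); lra.
have T2 : E0 * `|- q * (x - x0 - t * f a)| <= e / 2 * `|t|.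
  rewrite normrM normrN.
  apply: (@le_trans _ _ (E0 * ((`|q| + 1) * (e1 * `|t|)))).
    by rewrite ler_pM2l// ler_pM// lerDl.
  rewrite /e1 le_eqVlt; apply/orP; left; apply/eqP.
  by field; rewrite !gt_eqF.
rewrite (le_trans (ler_wpM2l (ltW E00) (ler_normD _ _)))// mulrDr.
by rewrite (le_trans (lerD T1 T2))//; lra.
Qed.

End power.
End log_family_gauge.

(** * Integration against image measures *)

Section integral_set_function.
Local Open Scope ereal_scope.
Context d (T : measurableType d) (R : realType).
Import HBNNSimple.

Let le_integral0 (m1 m2 : set T -> \bar R) (f : T -> \bar R) :
  (forall A, measurable A -> m1 A = m2 A) ->
  [set sintegral m1 h | h in [set h : {nnsfun T >-> R} | forall x, (h x)%:E <= f x]] `<=`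
  [set sintegral m2 h | h in [set h : {nnsfun T >-> R} | forall x, (h x)%:E <= f x]].
Proof.
move=> m12 _ [h hf <-]; exists h => //; apply: eq_fsbigr => r _.
by rewrite m12.
Qed.

(* [integral] makes sense for an arbitrary set function and only sees its values
   on measurable sets. *)
Lemma eq_integral_set_function (m1 m2 : set T -> \bar R) D (f : T -> \bar R) :
  (forall A, measurable A -> m1 A = m2 A) ->
  \int[m1]_(x in D) f x = \int[m2]_(x in D) f x.
Proof.
move=> m12; have m21 A : measurable A -> m2 A = m1 A by move=> mA; rewrite m12.
by rewrite /integral; congr (ereal_sup _ - ereal_sup _); apply/seteqP; split;
  exact: le_integral0.
Qed.

Lemma integral_set_function_mkcond (m : set T -> \bar R) D (f : T -> R) :
  \int[m]_(x in D) (f x)%:E = \int[m]_x ((f \_ D) x)%:E.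
Proof.
rewrite /integral patch_setT.
rewrite (_ : (fun x => (f x)%:E) \_ D = (fun x => ((f \_ D) x)%:E))//.
by apply/funext => x; rewrite !patchE; case: ifP.
Qed.

End integral_set_function.

Section pushforward_density.
Local Open Scope ereal_scope.
Context d1 d2 (T1 : measurableType d1) (T2 : measurableType d2) (R : realType).
Context (mu : {measure set T1 -> \bar R}) (phi : T1 -> T2) (W : T1 -> R).
Hypotheses (mphi : measurable_fun setT phi) (mW : measurable_fun setT W)
  (W0 : forall x, (0 <= W x)%R).
Import HBNNSimple.

Let nu (A : set T2) := \int[mu]_(x in phi @^-1` A) (W x)%:E.

Let nu0 : nu set0 = 0.
Proof. by rewrite /nu preimage_set0 integral_set0. Qed.

Let nu_ge0 A : 0 <= nu A.
Proof. by apply: integral_ge0 => x _; rewrite lee_fin. Qed.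

Let mpre A : measurable A -> measurable (phi @^-1` A).
Proof. by move=> mA; rewrite -[X in measurable X]setTI; exact: mphi. Qed.

Let nu_sigma_additive : semi_sigma_additive nu.
Proof.
move=> F mF tF mUF; rewrite /nu preimage_bigcup ge0_integral_bigcup//.
- by apply: is_cvg_nneseries => k _ _; exact: nu_ge0.
- by move=> k; exact: mpre.
- by apply/measurable_EFinP; exact: measurable_funS mW.
- by move=> x _; rewrite lee_fin.
- apply/trivIsetP => i k _ _ ik; rewrite -preimage_setI.
  by move/trivIsetP : tF => ->//; rewrite preimage_set0.
Qed.

HB.instance Definition _ := isMeasure.Build _ _ _ nu nu0 nu_ge0 nu_sigma_additive.

Let sintegral_pushforward_density (s : {nnsfun T2 >-> R}) :
  sintegral nu s = \int[mu]_x (s (phi x) * W x)%:E.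
Proof.
have ms r : measurable (s @^-1` [set r]) by [].
transitivity (\int[mu]_x
    (\sum_(r \in range s) (r * \1_(s @^-1` [set r]) (phi x) * W x)%:E)); last first.
  apply: eq_integral => x _; rewrite fsumEFin//; congr EFin.
  by rewrite [in RHS](fimfunE s) mulr_fsuml.
have mr r : measurable_fun setT (fun x => (r * \1_(s @^-1` [set r]) (phi x) * W x)%:E).
  apply/measurable_EFinP; apply: measurable_funM => //; apply: measurable_funM => //.
  by apply: measurableT_comp => //; exact: measurable_indic.
rewrite ge0_integral_fsum//; last first.
  move=> r x _; rewrite EFinM mule_ge0 ?lee_fin//.
  by have := nnfun_muleindic_ge0 s r (phi x); rewrite lee_fin.
rewrite sintegralE; apply: eq_fsbigr => r; rewrite inE => -[y _ yr].
have r0 : (0 <= r)%R by rewrite -yr.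
under eq_integral do rewrite -mulrA EFinM.
rewrite ge0_integralZl_EFin//; last 2 first.
- by move=> x _; rewrite lee_fin mulr_ge0.
- apply/measurable_EFinP; apply: measurable_funM => //.
  by apply: measurableT_comp => //; exact: measurable_indic.
congr (r%:E * _); change (nu (s @^-1` [set r]) = \int[mu]_x
  (\1_(s @^-1` [set r]) (phi x) * W x)%:E).
rewrite /nu [LHS]integral_mkcond; apply: eq_integral => x _.
rewrite patchE indicE; have [xr|xr] := boolP (x \in phi @^-1` (s @^-1` [set r])).
  by rewrite (_ : phi x \in _) ?mul1r//; rewrite inE in xr; rewrite inE.
rewrite (_ : phi x \in _ = false) ?mul0r//; apply/negbTE/negP => H.
by move/negP: xr; apply; rewrite inE in H; rewrite inE.
Qed.

(** Change of variables holds for simple functions by summing over level sets, and passes to [h] by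
    monotone convergence on both sides. *)
Lemma ge0_integral_pushforward_density (h : T2 -> R) :
  measurable_fun setT h -> (forall y, (0 <= h y)%R) ->
  \int[fun A => \int[mu]_(x in phi @^-1` A) (W x)%:E]_y (h y)%:E =
  \int[mu]_x (h (phi x) * W x)%:E.
Proof.
move=> mh h0; have mE : measurable_fun setT (EFin \o h) by exact/measurable_EFinP.
pose g := nnsfun_approx measurableT mE.
have gh y : EFin \o g ^~ y @ \oo --> (h y)%:E.
  by apply: cvg_nnsfun_approx => // z _; rewrite lee_fin.
have nd y : nondecreasing_seq (g ^~ y).
  by move=> a b ab; exact/lefP/nd_nnsfun_approx.
rewrite -/nu (@nd_ge0_integral_lim _ _ _ nu (EFin \o h) g)//=.
rewrite (_ : sintegral nu \o _ = fun k => \int[mu]_x (g k (phi x) * W x)%:E); last first.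
  by apply/funext => k; exact: sintegral_pushforward_density.
rewrite -monotone_convergence//.
- apply: eq_integral => x _; apply/cvg_lim => //.
  under eq_fun do rewrite EFinM.
  by rewrite EFinM; apply: cvgeZr => //; exact: gh.
- move=> k; apply/measurable_EFinP; apply: measurable_funM => //.
  by apply: measurableT_comp.
- by move=> k x _; rewrite lee_fin mulr_ge0.
- by move=> x _ a b ab; rewrite lee_fin ler_wpM2r//; exact: nd.
Qed.

(** Positive and negative parts are treated separately; multiplication by the nonnegative density
    [W] commutes with taking them. *)
Lemma integral_pushforward_density (h : T2 -> R) : measurable_fun setT h ->
  \int[fun A => \int[mu]_(x in phi @^-1` A) (W x)%:E]_y (h y)%:E =
  \int[mu]_x (h (phi x) * W x)%:E.
Proof.
move=> mh; change (\int[nu]_y (h y)%:E = \int[mu]_x (h (phi x) * W x)%:E).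
rewrite (integralE nu setT (fun y => (h y)%:E)).
rewrite (integralE mu setT (fun x => (h (phi x) * W x)%:E)).
apply: (f_equal2 (fun a b : \bar R => a - b)).
  transitivity (\int[nu]_y (Num.max (h y) 0%R)%:E).
    by apply: eq_integral => y _; rewrite funeposE EFin_max.
  rewrite ge0_integral_pushforward_density.
  - apply: eq_integral => x _; rewrite funeposE -EFin_max maxr_pMl//.
    by rewrite mul0r.
  - exact: measurable_maxr.
  - by move=> y; rewrite le_max lexx orbT.
transitivity (\int[nu]_y (Num.max (- h y) 0%R)%:E).
  by apply: eq_integral => y _; rewrite funenegE EFin_max.
rewrite ge0_integral_pushforward_density.
- apply: eq_integral => x _; rewrite funenegE -EFinN -EFin_max maxr_pMl//.
  by rewrite mul0r mulNr.
- by apply: measurable_maxr => //; exact: measurableT_comp.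
- by move=> y; rewrite le_max lexx orbT.
Qed.

End pushforward_density.

(** Prepares for dominated convergence, which concerns sequences; dropping finitely many terms keeps
    every t_k in the range where the estimates hold. *)
Lemma cvg_dnbhs0_seq (R : realType) (F : R -> R) (L d : R) : 0 < d ->
  (forall t : nat -> R, (forall k, 0 < `|t k| < d) -> t @ \oo --> 0 ->
    F (t k) @[k --> \oo] --> L) ->
  F t @[t --> 0^'] --> L.
Proof.
move=> d0 H; apply/cvgr_dnbhsP => s [s0 scvg].
have [N _ Nd] : \forall k \near \oo, `|s k| < d by exact: cvgr0_norm_lt.
rewrite -(cvg_shiftn N); apply: (H (fun k => s (k + N)%N)).
  by move=> k; rewrite normr_gt0 s0 Nd//= leq_addl.
by rewrite (cvg_shiftn N).
Qed.

(** * Integrals over the unit sphere *)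

Section sphere_integration.
Context {R : realType} {n : nat}.
Local Notation V := 'rV[R]_n.+1.
Local Notation SphT := (@SphT R n.+1).
Local Notation BorT := (@BorT R n.+1).
Local Notation mu := (@sph_measure R n.+1).

Lemma le_sph_measure (E F : set V) : E `<=` F ->
  (sph_measure (E : set SphT) <= sph_measure (F : set SphT))%E.
Proof.
move=> EF; apply: lee_wpmul2l => //; apply: le_leb_outer; apply: cone01_sub.
by move=> x [/EF].
Qed.

Lemma measurable_mod_null (E F N : set SphT) : measurable F -> measurable N ->
  mu N = 0%E -> E `\` N = F `\` N -> measurable E.
Proof.
move=> mF mN N0 EF.
have -> : E = (E `&` N) `|` (F `\` N).
  rewrite -EF; apply/seteqP; split => [x Ex|x [[]|[]]//].
  by have [Nx|Nx] := pselect (N x); [left|right].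
apply: measurableU; last exact: measurableD.
apply: measurable_sph_measure_eq0; apply/eqP; rewrite eq_le sph_measure_ge0 andbT.
by rewrite -N0; apply: le_sph_measure; exact: subIsetr.
Qed.

Lemma measurable_sphere : measurable (sphere : set BorT).
Proof. by apply: measurable_closed_BorT; exact: closed_sphere. Qed.

Lemma measurable_sphere_SphT : measurable (sphere : set SphT).
Proof. exact: measurable_BorT_SphT measurable_sphere. Qed.

Lemma sphere_integrable (h : V -> R) (B : R) :
  measurable_fun (sphere : set SphT) (h : SphT -> R) ->
  (forall u, sphere u -> `|h u| <= B) ->
  mu.-integrable (sphere : set SphT) (EFin \o h).
Proof.
move=> mh hB; apply: measurable_bounded_integrable => //.
- exact: measurable_sphere_SphT.
- exact: sph_measure_fin.
- exists B; split; first exact: num_real.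
  by move=> y By u u1; rewrite /= (le_trans (hB u u1))// ltW.
Qed.

Lemma star_body_weight (Q : set V) (p : R) : star_body Q ->
  measurable_fun (sphere : set SphT) ((fun u => radial Q u `^ p) : SphT -> R) /\
  exists2 B, 0 < B & forall u, sphere u -> radial Q u `^ p <= B.
Proof.
move=> [_ _ Q0 cQ]; split.
  apply: (@measurableT_comp _ _ _ _ _ _ (@powR R ^~ p)); first exact: measurable_powR.
  apply: measurable_fun_BorT_SphT; last exact: measurable_sphere.
  by apply: within_continuous_measurable => //; exact: measurable_sphere.
have s0 : @sphere R n.+1 !=set0.
  exists (delta_mx ord0 ord0); by rewrite /sphere/= dotp_delta mxE !eqxx.
have [a aS am] := EVT_min_rV s0 compact_sphere cQ.
have [b bS bm] := EVT_max_rV s0 compact_sphere cQ.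
have a0 : 0 < radial Q a by apply: Q0; rewrite inE in aS.
have [B B0 HB] := @powR_bounded R _ (radial Q b) p a0.
by exists B => // u u1; apply: HB; rewrite am ?bm ?inE.
Qed.

End sphere_integration.

(** * The variational formula *)

Section gauss_map.
Context {R : realType} {n : nat}.
Local Notation V := 'rV[R]_n.+1.
Local Notation SphT := (@SphT R n.+1).
Local Notation BorT := (@BorT R n.+1).
Local Notation mu := (@sph_measure R n.+1).
Context (Omega : set V) (rho : V -> R).
Hypotheses (cO : closed Omega) (Osph : Omega `<=` sphere).
Hypothesis hemi : ~ (exists v, sphere v /\ forall u, Omega u -> 0 <= dotp u v).
Hypotheses (rho_gt0 : forall u, Omega u -> 0 < rho u)
  (crho : {within Omega, continuous rho}).
Local Notation g := (wsup Omega rho).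
Local Notation M := (polar (rho_hull Omega rho)).
Implicit Types (u v w : V).

Let On0 := Omega_nonempty hemi.
Let cptO := compact_Omega cO Osph.
Let sg := wsup_sublinear On0 cptO crho.

Let N : set SphT := kinks g.

Lemma measurable_gauge : measurable_fun (setT : set BorT) (g : BorT -> R).
Proof.
apply: within_continuous_measurable; first exact: measurableT.
by apply: continuous_subspaceT; exact: sublinear_continuous sg.
Qed.

Lemma measurable_gauge_power (q : R) :
  measurable_fun (sphere : set SphT) ((fun u => (g u)^-1 `^ q) : SphT -> R).
Proof.
apply: (@eq_measurable_fun _ _ _ _ _
    ((fun u => expR (- q * ln (g u))) : SphT -> R)).
  by move=> u; rewrite inE => u1; rewrite (gauge_powerE cO Osph hemi q rho_gt0 crho u1).
apply: measurableT_comp => //; apply: measurable_funM => //.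
apply: (measurableT_comp (@measurable_ln R)).
apply: measurable_fun_BorT_SphT; last exact: measurable_sphere.
exact: (measurable_funS measurableT (@subsetT _ _) measurable_gauge).
Qed.

Lemma gauge_power_bounded (q : R) :
  exists2 B, 0 < B & forall u, sphere u -> (g u)^-1 `^ q <= B.
Proof.
have [m [m' [m0 mm gm]]] := gauge_bounds cO Osph hemi rho_gt0 crho.
have [B B0 HB] := @powR_bounded R m'^-1 m^-1 q ltac:(by rewrite invr_gt0 (lt_le_trans m0)).
exists B => // u u1; apply: HB; have /andP[g1 g2] := gm u u1.
have g0 : 0 < g u by exact: lt_le_trans g1.
by rewrite !lef_pV2 ?posrE ?g1 ?g2// (lt_le_trans m0).
Qed.

Lemma measurable_kinks_SphT : measurable N.
Proof. by apply: measurable_BorT_SphT; exact: measurable_kinks. Qed.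

Lemma maximizer_eq u v w : ~ kinks g u -> Omega v -> Omega w ->
  g u = rho v * dotp v u -> g u = rho w * dotp w u -> v = w.
Proof.
move=> uN Ov Ow gv gw.
apply: (@sphere_scale_eq _ _ v w (rho v) (rho w)); [exact: Osph|exact: Osph|exact: rho_gt0|exact: rho_gt0|].
apply: (maximizer_unique cO Osph hemi crho uN Ow gw) => [y|].
  by rewrite dotpZl; exact: wsup_ge.
by rewrite dotpZl.
Qed.

Context (alpha : V -> V).
Hypothesis alphaP : forall u, Omega (alpha u) /\ g u = rho (alpha u) * dotp (alpha u) u.

(** [alpha] is an arbitrary choice of maximizers. Off the kinks, alpha(u) lies in a closed set C
    exactly when the maximum over Omega and C together equals the one over [Omega], a closed
    condition on u; completeness absorbs the kinks. *)
Lemma measurable_alpha : measurable_fun (setT : set SphT) (alpha : SphT -> BorT).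
Proof.
have closed_case C : closed C -> measurable (alpha @^-1` C : set SphT).
  move=> cC; have [C0|C0] := pselect (Omega `&` C !=set0); last first.
    rewrite (_ : alpha @^-1` C = set0)//.
    apply/seteqP; split => // u Cu; apply: C0; exists (alpha u); split => //.
    exact: (alphaP u).1.
  have cptC : compact (Omega `&` C).
    by apply: (subclosed_compact _ cptO); [exact: closedI|exact: subIsetl].
  have crC : {within Omega `&` C, continuous rho}.
    by apply: continuous_subspaceW crho; exact: subIsetl.
  pose gC := wsup (Omega `&` C) rho.
  apply: (@measurable_mod_null _ _ _ [set u | gC u = g u] N) => //.
  - apply: measurable_BorT_SphT; apply: measurable_closed_BorT.
    rewrite (_ : [set u | gC u = g u] = (fun u => gC u - g u) @^-1` [set 0]).
      apply: preimage_closed.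
        move=> u _; apply: continuousB.
          exact: (sublinear_continuous (wsup_sublinear C0 cptC crC)).
        exact: (sublinear_continuous sg).
      exact/accessible_closed_set1/hausdorff_accessible/norm_hausdorff.
    by apply/seteqP; split => u /= => [->|/eqP]; rewrite ?subrr ?subr_eq0// => /eqP.
  - exact: measurable_kinks_SphT.
  - exact: sph_measure_kinks.
  - apply/seteqP; split => u [uC uN]; split => //=; have [Oa ga] := alphaP u.
      apply/eqP; rewrite eq_le; apply/andP; split.
        by apply: (wsup_le C0 cptC crC) => v [Ov _]; exact: wsup_ge.
      by rewrite [leLHS]ga; apply: (wsup_ge C0 cptC crC).
    have [v [Ov Cv] gv] := wsup_attained C0 cptC crC u.
    by rewrite /preimage/= (maximizer_eq uN Oa Ov ga)// -gv.
apply: (@measurability _ _ SphT BorT setT alpha (@open V) erefl) => _ [C oC <-].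
rewrite setTI -[C]setCK preimage_setC; apply: measurableC.
by apply: (closed_case (~` C)); exact: open_closedC.
Qed.

(** A maximizer is an outer normal at every direction, and off the kinks it is the only one; these
    two facts give the two inclusions. *)
Lemma Rstar_mod_kinks (eta : set V) :
  Rstar M (eta `&` sphere) `\` N = (alpha @^-1` eta `&` sphere) `\` N.
Proof.
apply/seteqP; split => [u [[u1 [v [[ev v1] _ E]]] uN]|u [[eu u1] uN]].
  have [Oa ga] := alphaP u; split => //; split => //.
  rewrite /preimage/=.
  by rewrite -(outer_normal_maximizer cO Osph hemi rho_gt0 crho uN u1 v1 Oa ga E).
have [Oa ga] := alphaP u; split => //; split => //; exists (alpha u); split => //.
- by split => //; exact: Osph.
- exact: Osph.
- exact: (support_maximizer cO Osph hemi rho_gt0 crho u1 Oa ga).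
Qed.

Lemma dualC_pushforward (q j : R) (Q : set V) (eta : set BorT) : star_body Q ->
  measurable eta ->
  dualC q j M Q eta = (\int[mu]_(u in (alpha @^-1` eta : set SphT))
    (((fun u => n.+1%:R^-1 * ((g u)^-1 `^ q * radial Q u `^ (n.+1%:R - q - j)))
      \_ sphere) u)%:E)%E.
Proof.
move=> sQ meta; set p := n.+1%:R - q - j.
have [mw _] := star_body_weight p sQ.
pose P (u : SphT) := (g u)^-1 `^ q * radial Q u `^ p.
have mP : measurable_fun (sphere : set SphT) P.
  by apply: measurable_funM => //; exact: measurable_gauge_power.
have P0 u : 0 <= P u by rewrite mulr_ge0// powR_ge0.
pose E1 : set SphT := Rstar M (eta `&` sphere).
pose E2 : set SphT := alpha @^-1` eta `&` sphere.
have mE2 : measurable E2.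
  apply: measurableI; last exact: measurable_sphere_SphT.
  by rewrite -[X in measurable X]setTI; exact: measurable_alpha.
have E12 : E1 `\` N = E2 `\` N by exact: Rstar_mod_kinks.
have mN := measurable_kinks_SphT.
have N0 : mu N = 0%E by exact: sph_measure_kinks.
have mE1 : measurable E1 by apply: (measurable_mod_null mE2 mN N0).
have E1s : E1 `<=` sphere by move=> u [].
have E2s : E2 `<=` sphere by exact: subIsetr.
have mPE (E : set SphT) : E `<=` sphere -> measurable_fun E (EFin \o P).
  move=> Es; apply/measurable_EFinP; apply: measurable_funS mP => //.
  exact: measurable_sphere_SphT.
rewrite /dualC.
transitivity ((n.+1%:R^-1)%:E * \int[mu]_(u in E1) (P u)%:E)%E.
  apply: (f_equal (fun z => (n.+1%:R^-1)%:E * z)%E); apply: eq_integral => u.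
  rewrite inE => /E1s u1.
  by rewrite radial_polarE//; exact: gauge_gt0 (sphere_neq0 u1).
(* [E1] and [E2] agree outside the null set [N], so the integral passes from one to the other. *)
rewrite (@ge0_negligible_integral _ _ _ mu E1 N)//; last 2 first.
- exact: mPE.
- by move=> u _; rewrite lee_fin.
rewrite E12 -(@ge0_negligible_integral _ _ _ mu E2 N)//; last 2 first.
- exact: mPE.
- by move=> u _; rewrite lee_fin.
rewrite -ge0_integralZl_EFin//; last 2 first.
- by move=> u _; rewrite lee_fin.
- exact: mPE.
rewrite /E2 integral_mkcondr; apply: eq_integral => u _.
by rewrite !patchE; case: ifP.
Qed.

End gauss_map.

Section variational_formula.
Context {R : realType} {n : nat}.
Local Notation V := 'rV[R]_n.+1.
Local Notation SphT := (@SphT R n.+1).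
Local Notation BorT := (@BorT R n.+1).
Local Notation mu := (@sph_measure R n.+1).
Context (Omega : set V) (rho0 f : V -> R) (rho : R -> V -> R) (q j : R) (Q : set V).
Hypotheses (cO : closed Omega) (Osph : Omega `<=` sphere).
Hypothesis hemi : ~ (exists v, sphere v /\ forall u, Omega u -> 0 <= dotp u v).
Hypotheses (rho0_gt0 : forall u, Omega u -> 0 < rho0 u)
  (crho0 : {within Omega, continuous rho0}) (cf : {within Omega, continuous f}).
Hypothesis lf : log_family Omega rho0 f rho.
Hypothesis sQ : star_body Q.

Let On0 := Omega_nonempty hemi.
Let cptO := compact_Omega cO Osph.
Local Notation p := (n.+1%:R - q - j).
Local Notation G c u := ((wsup Omega c u)^-1 `^ q).
Let w (u : SphT) : R := radial Q u `^ p.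
Let mw : measurable_fun (sphere : set SphT) w.
Proof. exact: (star_body_weight p sQ).1. Qed.

Lemma dualW_polarE (c : V -> R) : (forall u, Omega u -> 0 < c u) ->
  {within Omega, continuous c} ->
  dualW q j (polar (rho_hull Omega c)) Q =
  n.+1%:R^-1 * \int[mu]_(u in (sphere : set SphT)) (G c u * w u).
Proof.
move=> c0 cc; apply: (f_equal (fun z => n.+1%:R^-1 * fine z)).
apply: eq_integral => u; rewrite inE => u1.
by rewrite radial_polarE//; exact: (gauge_gt0 cO Osph hemi c0 cc (sphere_neq0 u1)).
Qed.

Lemma cvg_dualW_quotient (alpha : V -> V) :
  (forall u, Omega (alpha u) /\
     wsup Omega rho0 u = rho0 (alpha u) * dotp (alpha u) u) ->
  ((dualW q j (polar (rho_hull Omega (rho t))) Q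
    - dualW q j (polar (rho_hull Omega rho0)) Q) / t) @[t --> 0^'] -->
  - q * fine (\int[dualC q j (polar (rho_hull Omega rho0)) Q]_(u in (Omega : set BorT))
    (f u)%:E)%E.
Proof.
move=> alphaP.
have [Bw Bw0 wB] := (star_body_weight p sQ).2.
have w0 u : 0 <= w u by exact: powR_ge0.
have [BG BG0 GB] := gauge_power_bounded cO Osph hemi rho0_gt0 crho0 q.
have G0 u : 0 <= G rho0 u by exact: powR_ge0.
have mG0 := measurable_gauge_power cO Osph hemi rho0_gt0 crho0 q.
have [F F0 fF] := within_continuous_bounded On0 cptO cf.
have mS := @measurable_sphere_SphT R n.
have mh : measurable_fun (setT : set BorT) ((f \_ Omega) : BorT -> R).
  have mO := measurable_closed_BorT cO.
  by apply/(measurable_restrictT _ mO); exact: within_continuous_measurable.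
have malpha := measurable_alpha cO Osph hemi rho0_gt0 crho0 alphaP.
have fa u : (f \_ Omega) (alpha u) = f (alpha u).
  by rewrite patchE mem_set//; exact: (alphaP u).1.
have mfa : measurable_fun (setT : set SphT) ((fun u => f (alpha u)) : SphT -> R).
  rewrite (_ : (fun u => f (alpha u)) = (f \_ Omega) \o alpha).
    exact: measurableT_comp mh malpha.
  by apply/funext => u /=; rewrite fa.
pose I (u : SphT) := f (alpha u) * (G rho0 u * w u).
have mI : measurable_fun (sphere : set SphT) I.
  apply: measurable_funM; first exact: (measurable_funS measurableT (@subsetT _ _) mfa).
  exact: measurable_funM.
have I_int : mu.-integrable (sphere : set SphT) (EFin \o I).
  apply: (@sphere_integrable _ _ _ (F * (BG * Bw))) => // u u1.
  rewrite normrM (ger0_norm (mulr_ge0 (G0 u) (w0 u))).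
  apply: ler_pM => //; [exact: mulr_ge0|exact/fF/(alphaP u).1|].
  by apply: ler_pM => //; [exact: GB|exact: wB].
have -> : (\int[dualC q j (polar (rho_hull Omega rho0)) Q]_(u in (Omega : set BorT))
    (f u)%:E = \int[mu]_(u in (sphere : set SphT)) (n.+1%:R^-1 * I u)%:E)%E.
  pose W : SphT -> R := (fun u => n.+1%:R^-1 * (G rho0 u * w u)) \_ sphere.
  (* [dualC] is only a set function; it agrees on Borel sets with the image measure [nu], to which
     the change of variables applies. *)
  pose nu (eta : set BorT) : \bar R :=
    (\int[mu]_(u in (alpha @^-1` eta : set SphT)) (W u)%:E)%E.
  rewrite (@eq_integral_set_function _ BorT R _ nu); last first.
    by move=> eta meta; exact: (dualC_pushforward cO Osph hemi rho0_gt0 crho0 alphaP).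
  rewrite integral_set_function_mkcond.
  rewrite (@integral_pushforward_density _ _ SphT BorT R mu alpha W)//; first last.
  - move=> u; rewrite /W patchE; case: ifP => // _.
    by rewrite mulr_ge0 ?invr_ge0// mulr_ge0.
  - by apply/(measurable_restrictT _ mS); apply: measurable_funM => //; exact: measurable_funM.
  rewrite [RHS]integral_mkcond; apply: eq_integral => u _.
  by rewrite fa /W !patchE; case: ifP => _; rewrite ?mulr0// /I mulrCA.
have [d1 [B [d10 B0 QB]]] :=
  gauge_power_quotient_bounded cO Osph hemi rho0_gt0 crho0 cf lf q.
have [C [d2 [_ d20 lip]]] := log_family_lipschitz cO Osph hemi cf lf.
(* Up to the factor 1 / n, the integrand of the difference quotient of [dualW]. *)
pose D t (u : SphT) := (G (rho t) u - G rho0 u) / t * w u.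
have mD t : 0 < `|t| < d2 -> measurable_fun (sphere : set SphT) (D t).
  move=> /lip[rt crt _]; apply: measurable_funM => //.
  apply: measurable_funM => //; apply: measurable_funB => //.
  exact: measurable_gauge_power.
have DB t u : 0 < `|t| < d1 -> sphere u -> `|D t u| <= B * Bw.
  move=> td u1; rewrite normrM (ger0_norm (w0 u)).
  by apply: ler_pM => //; [exact: QB|exact: wB].
have quotE t : 0 < `|t| < Num.min d1 d2 ->
    (dualW q j (polar (rho_hull Omega (rho t))) Q
      - dualW q j (polar (rho_hull Omega rho0)) Q) / t =
    n.+1%:R^-1 * \int[mu]_(u in (sphere : set SphT)) D t u.
  rewrite lt_min => /and3P[t0 td1 td2].
  have t1 : 0 < `|t| < d1 by rewrite t0.
  have t2 : 0 < `|t| < d2 by rewrite t0.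
  have tn0 : t != 0 by rewrite -normr_gt0.
  have [rt crt _] := lip t t2.
  have D_int : mu.-integrable (sphere : set SphT) (EFin \o D t).
    by apply: (@sphere_integrable _ _ _ (B * Bw)) => [|u]; [exact: mD|exact: DB].
  have G_int : mu.-integrable (sphere : set SphT) (EFin \o (fun u => G rho0 u * w u)).
    apply: (@sphere_integrable _ _ _ (BG * Bw)); first exact: measurable_funM.
    move=> u u1; rewrite (ger0_norm (mulr_ge0 (G0 u) (w0 u))).
    by apply: ler_pM => //; [exact: GB|exact: wB].
  rewrite !dualW_polarE//.
  have -> : \int[mu]_(u in (sphere : set SphT)) (G (rho t) u * w u) =
      \int[mu]_(u in (sphere : set SphT)) (G rho0 u * w u + t * D t u).
    apply: eq_Rintegral => u _; rewrite /D mulrA mulrCA divff// mulr1.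
    by rewrite -mulrDl addrC subrK.
  rewrite RintegralD//; last first.
    rewrite (_ : EFin \o _ = (fun u => t%:E * (D t u)%:E)%E); first exact: integrableZl.
    by apply/funext => u /=; rewrite EFinM.
  rewrite RintegralZl// -mulrBr addrAC subrr add0r -mulrA; congr (_ * _).
  by rewrite mulrAC divff// mul1r.
apply: (@cvg_dnbhs0_seq _ _ _ (Num.min d1 d2)); first by rewrite lt_min d10.
move=> t td t0.
have td12 k : 0 < `|t k| < d1 /\ 0 < `|t k| < d2.
  by have := td k; rewrite lt_min => /and3P[-> -> ->].
under eq_fun do rewrite quotE//.
have -> : - q * fine (\int[mu]_(u in (sphere : set SphT)) (n.+1%:R^-1 * I u)%:E)%E =
    n.+1%:R^-1 * \int[mu]_(u in (sphere : set SphT)) (- q * I u).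
  rewrite -/(Rintegral mu sphere (fun u => n.+1%:R^-1 * I u)).
  by rewrite !RintegralZl// mulrCA.
apply: cvgM; first exact: cvg_cst.
have L_int : mu.-integrable (sphere : set SphT) (EFin \o (fun u => - q * I u)).
  rewrite (_ : EFin \o _ = (fun u => (- q)%:E * (I u)%:E)%E); first exact: integrableZl.
  by apply/funext => u /=; rewrite EFinM.
apply: fine_cvg; rewrite fineK; last exact: integrable_fin_num.
have [|||||_ _ //] := @dominated_convergence _ SphT R mu sphere mS
  (fun k u => (D (t k) u)%:E) (fun u => (- q * I u)%:E) (cst (B * Bw)%:E).
- by move=> k; apply/measurable_EFinP; apply: mD; exact: (td12 k).2.
- by apply/measurable_EFinP; apply: measurable_funM.
(* The kinks are the exceptional null set: elsewhere the maximizer is unique and the pointwise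
   derivative exists. *)
- exists (kinks (wsup Omega rho0)); split.
  + exact: (measurable_kinks_SphT cO Osph hemi crho0).
  + exact: (sph_measure_kinks (wsup_sublinear On0 cptO crho0)).
  + move=> u /= nu; apply: contrapT => uN; apply: nu => u1.
    have [Oa ga] := alphaP u.
    have ua v : Omega v -> wsup Omega rho0 u = rho0 v * dotp v u -> v = alpha u.
      by move=> Ov gv; exact: (maximizer_eq cO Osph hemi rho0_gt0 crho0 uN Ov Oa gv ga).
    apply: cvg_EFin; first by apply: nearW.
    apply/cvgrPdist_le => e e0.
    (* The weight is at most [Bw], so accuracy e / Bw for the power of the gauge gives accuracy e
       for the integrand. *)
    have e1 : 0 < e / Bw by rewrite divr_gt0.
    have [d d0 der] := gauge_power_deriv cO Osph hemi rho0_gt0 crho0 cf lf q u1 Oa ga ua e1.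
    have [K _ Kd] : \forall k \near \oo, `|t k| < d by exact: cvgr0_norm_lt.
    exists K => // k /Kd/= tkd; rewrite /D /I distrC.
    have -> : (G (rho (t k)) u - G rho0 u) / t k * w u -
        - q * (f (alpha u) * (G rho0 u * w u)) =
      ((G (rho (t k)) u - G rho0 u) / t k - (- q * f (alpha u) * G rho0 u)) * w u.
      by rewrite [RHS]mulrBl !mulrA.
    rewrite normrM (ger0_norm (w0 u)) -(divfK (lt0r_neq0 Bw0) e).
    apply: ler_pM => //; last exact: wB.
    by apply: der; rewrite tkd andbT; have /andP[] := (td12 k).1.
- apply: (@sphere_integrable _ _ (cst (B * Bw)) (B * Bw)) => // u _ /=.
  by rewrite ger0_norm// mulr_ge0// ltW.
- apply: aeW => u k u1; rewrite lee_fin; apply: DB => //; exact: (td12 k).1.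
Qed.

End variational_formula.

Theorem theorem4p1 (R : realType) (n : nat) (Omega : set 'rV[R]_n)
    (rho0 f : 'rV[R]_n -> R) (rho : R -> 'rV[R]_n -> R) (q j : R)
    (Q : set 'rV[R]_n) :
  (2 <= n)%N ->
  closed Omega -> Omega `<=` sphere ->
  ~ (exists v, sphere v /\ forall u, Omega u -> 0 <= dotp u v) ->
  (forall u, Omega u -> 0 < rho0 u) -> {within Omega, continuous rho0} ->
  {within Omega, continuous f} ->
  log_family Omega rho0 f rho ->
  q != 0 -> j != n%:R ->
  star_body Q ->
  ((dualW q j (polar (rho_hull Omega (rho t))) Q
             - dualW q j (polar (rho_hull Omega rho0)) Q) / t)
    @[t --> 0^'] -->
  - q * fine (\int[dualC q j (polar (rho_hull Omega rho0)) Q]_(u in (Omega : set BorT))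
                (f u)%:E)%E.
Proof.
(* The bound on the dimension excludes zero, so the results for successor dimensions apply. *)
case: n Omega rho0 f rho Q => // n Omega rho0 f rho Q _ cO Osph hemi r0 cr0 cf lf _ _ sQ.
(* A maximizer exists for every u by compactness; where there are several, [alpha] picks one
   arbitrarily. *)
have /choice[alpha alphaP] u : exists v,
    Omega v /\ wsup Omega rho0 u = rho0 v * dotp v u.
  have [v Ov gv] := wsup_attained (Omega_nonempty hemi) (compact_Omega cO Osph) cr0 u.
  by exists v.
exact: (cvg_dualW_quotient cO Osph hemi r0 cr0 cf lf sQ alphaP).
Qed.
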